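(* Let $\Bbbk$ be a perfect field of characteristic $2$ and let $X\subset\mathbb{P}^{2m}$ be a smooth complete intersection of two quadrics defined over $\Bbbk$. If $\dim X=2$, then $X$ is unirational over $\Bbbk$. If $\dim X>2$, then $X$ is rational over $\Bbbk$.
   Context: $X$ is unirational over $\Bbbk$ if there is a dominant rational map $\mathbb{P}^N_{\Bbbk}\dashrightarrow X$ defined over $\Bbbk$ for some $N$, and rational over $\Bbbk$ if it is birational over $\Bbbk$ to $\mathbb{P}^{\dim X}_{\Bbbk}$. *)

(* Defs.v *)
From HB Require Import structures.
From mathcomp Require Import all_boot all_order all_algebra all_field.
From mathcomp.multinomials Require Export mpoly.

Set Implicit Arguments.
Unset Strict Implicit.
Unset Printing Implicit Defensive.

Import GRing.Theory.
Local Open Scope ring_scope.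

Definition perfect_field (k : fieldType) : Prop :=
  forall p : {poly k}, irreducible_poly p -> separable_poly p.

(* Points of P^n are represented by nonzero coordinate vectors with entries in
   an arbitrary field extension f : k -> K.  As K ranges over all extensions,
   these account for every geometric point and every scheme-theoretic point of
   P^n over k; no algebraic closure of k has to be chosen. *)
Section Points.
Variables (k K : fieldType) (f : {rmorphism k -> K}).

Definition nonzero_vec n (x : 'I_n -> K) : Prop := exists i, x i != 0.

Definition eval_at n (g : {mpoly k[n]}) (x : 'I_n -> K) : K :=
  (map_mpoly f g).@[x].

Definition eval_map r s (F : 'I_s -> {mpoly k[r]}) (x : 'I_r -> K) : 'I_s -> K :=
  fun i => eval_at (F i) x.

Definition same_point n (x y : 'I_n -> K) : Prop :=
  exists2 c : K, c != 0 & forall i, y i = c * x i.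

(* A set of equations, given by its membership predicate, stands for the subset
   of P^n that it cuts out. *)
Definition in_zeros n (S : {mpoly k[n.+1]} -> Prop) (x : 'I_n.+1 -> K) : Prop :=
  nonzero_vec x /\ forall g, S g -> eval_at g x = 0.

Definition jacobian n r (q : r.-tuple {mpoly k[n.+1]}) (x : 'I_n.+1 -> K) :
    'M[K]_(r, n.+1) :=
  \matrix_(i < r, j < n.+1) eval_at (tnth q i)^`M(j) x.

End Points.

Section ProjectiveSets.
Variable k : fieldType.

Definition eqns n := {mpoly k[n.+1]} -> Prop.

Definition homogeneous n (S : eqns n) : Prop :=
  forall g, S g -> exists e : nat, g \is e.-homog.

Definition proj_space n : eqns n := fun _ => False.

Definition eqns_of n r (q : r.-tuple {mpoly k[n.+1]}) : eqns n :=
  fun g => g \in q.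

Definition closed_sub n (S T : eqns n) : Prop :=
  forall (K : fieldType) (f : {rmorphism k -> K}) (x : 'I_n.+1 -> K),
    in_zeros f S x -> in_zeros f T x.

Definition nonempty n (S : eqns n) : Prop :=
  exists (K : fieldType) (f : {rmorphism k -> K}) (x : 'I_n.+1 -> K),
    in_zeros f S x.

Definition irreducible n (S : eqns n) : Prop :=
  nonempty S /\
  forall A B : eqns n, homogeneous A -> homogeneous B ->
    (forall (K : fieldType) (f : {rmorphism k -> K}) (x : 'I_n.+1 -> K),
       in_zeros f S x -> in_zeros f A x \/ in_zeros f B x) ->
    closed_sub S A \/ closed_sub S B.

Definition irreducible_chain n (X : eqns n) (d : nat) (Z : nat -> eqns n) : Prop :=
  [/\ forall i, (i <= d)%N ->
        [/\ homogeneous (Z i), irreducible (Z i) & closed_sub (Z i) X]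
    & forall i, (i < d)%N ->
        closed_sub (Z i) (Z i.+1) /\ ~ closed_sub (Z i.+1) (Z i)].

(* Krull dimension of the Zariski topology; the empty set has no dimension. *)
Definition has_dim n (X : eqns n) (d : nat) : Prop :=
  (exists Z, irreducible_chain X d Z) /\
  (forall e Z, irreducible_chain X e Z -> (e <= d)%N).

(* r forms cutting out a subscheme of P^n of codimension r. *)
Definition complete_intersection n r (q : r.-tuple {mpoly k[n.+1]}) : Prop :=
  exists2 d, (d + r = n)%N & has_dim (eqns_of q) d.

(* Jacobian criterion for the subscheme of P^n defined by the forms in q. *)
Definition smooth n r (q : r.-tuple {mpoly k[n.+1]}) : Prop :=
  exists2 d, has_dim (eqns_of q) d &
    forall (K : fieldType) (f : {rmorphism k -> K}) (x : 'I_n.+1 -> K),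
      in_zeros f (eqns_of q) x -> (\rank (jacobian f q x) + d = n)%N.

(* A rational map between closed subsets X of P^r and Y of P^s.  Clearing
   denominators, it is given by s+1 forms of one degree with coefficients in k;
   the open subset of X where they do not all vanish must be dense. *)
Definition rational_map r s (X : eqns r) (Y : eqns s)
    (F : 'I_s.+1 -> {mpoly k[r.+1]}) : Prop :=
  [/\ exists e : nat, forall i, F i \is e.-homog,
      forall Z : eqns r, homogeneous Z ->
        (forall (K : fieldType) (f : {rmorphism k -> K}) (x : 'I_r.+1 -> K),
           in_zeros f X x -> nonzero_vec (eval_map f F x) -> in_zeros f Z x) ->
        closed_sub X Z
    & forall (K : fieldType) (f : {rmorphism k -> K}) (x : 'I_r.+1 -> K),
        in_zeros f X x -> nonzero_vec (eval_map f F x) ->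
        in_zeros f Y (eval_map f F x)].

Definition dominant r s (X : eqns r) (Y : eqns s)
    (F : 'I_s.+1 -> {mpoly k[r.+1]}) : Prop :=
  forall Z : eqns s, homogeneous Z ->
    (forall (K : fieldType) (f : {rmorphism k -> K}) (x : 'I_r.+1 -> K),
       in_zeros f X x -> nonzero_vec (eval_map f F x) ->
       in_zeros f Z (eval_map f F x)) ->
    closed_sub Y Z.

(* G o F is the identity of X wherever the forms G(F) do not all vanish. *)
Definition left_inverse r s (X : eqns r)
    (F : 'I_s.+1 -> {mpoly k[r.+1]}) (G : 'I_r.+1 -> {mpoly k[s.+1]}) : Prop :=
  forall (K : fieldType) (f : {rmorphism k -> K}) (x : 'I_r.+1 -> K),
    in_zeros f X x -> nonzero_vec (eval_map f F x) ->
    nonzero_vec (eval_map f G (eval_map f F x)) ->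
    same_point x (eval_map f G (eval_map f F x)).

(* Dominance of F and G guarantees that both composites are defined on
   nonempty open sets. *)
Definition birational r s (X : eqns r) (Y : eqns s) : Prop :=
  exists (F : 'I_s.+1 -> {mpoly k[r.+1]}) (G : 'I_r.+1 -> {mpoly k[s.+1]}),
    [/\ rational_map X Y F /\ dominant X Y F,
        rational_map Y X G /\ dominant Y X G,
        left_inverse X F G
      & left_inverse Y G F].

Definition unirational n (X : eqns n) : Prop :=
  exists N (F : 'I_n.+1 -> {mpoly k[N.+1]}),
    rational_map (@proj_space N) X F /\ dominant (@proj_space N) X F.

Definition rational n (X : eqns n) : Prop :=
  exists2 d, has_dim X d & birational X (@proj_space d).

End ProjectiveSets.

(* Main.v *)
Require Import Defs.
From HB Require Import structures.
From mathcomp Require Import all_boot all_order all_algebra all_field.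
From mathcomp.multinomials Require Import mpoly.
From mathcomp Require Import ring zify.
From Stdlib Require Import Classical.
Set Implicit Arguments.
Unset Strict Implicit.
Unset Printing Implicit Defensive.
Import GRing.Theory.
Local Open Scope ring_scope.

(** Write X for the common zeros of q1 and q2, and b1, b2 for their polar
    forms.  In characteristic 2 the polar forms are alternating, and this is
    what produces rational points on X: on a space of odd dimension 2m+1, b1
    has a vector v in its radical; passing to the b2-orthogonal of v modulo v
    lowers the dimension by two, and induction gives a subspace W of dimension
    m+1 on which b1 and b2 both vanish ([common_isotropic]).  On W the forms
    q_i are additive, hence over a perfect field they are squares of linear
    forms, and X contains the projective space P^(m-2) cut out in P(W) by two
    linear equations ([isotropic_zeros]).

    If dim X > 2, then m >= 3 and X contains a line.  Projection from this line
    is birational: a plane through the line meets the two quadrics in two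
    residual lines, which intersect in one further point of X, found by
    Cramer's rule ([unproject]).  The only serious issue is that the points
    where the determinant [contact] of the linear system is not zero are dense
    in X ([dense_off_contact]).  A point x of X off the line is the limit at
    t = 0 of a curve unproject (x + t y), divided by a power of t, with y a
    tangent vector at x ([curve_limit]).  A tangent vector for which the limit is x
    exists because otherwise a combination of x and of points of the line would
    be a singular point of X.  Points of the line are limits of similar curves
    or of points of X off the line ([dense_on_line]).

    If dim X = 2, then W has dimension 3 and X meets P(W) in one point p, for
    otherwise two points of a line in P(W) would have the same tangent space
    ([tangent_distinct]).  The tangent plane of X at p is P(W), and there is a
    basis e1, e2 of W modulo p in which q1 and q2 are the squares of the two
    coordinates ([exists_frame]).  The hyperplanes containing P(W) cut X in a
    pencil of curves, birational to the conics s q1 + t q2 = 0 of the projection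
    from p.  After the inseparable base change s = d2^2, t = - d1^2 such a conic
    has the point d1 e1 + d2 e2, so it is parametrized by the lines through this
    point ([conic_pt]).  The resulting map from P^6 to X hits every point other
    than p for which d1 e1 + d2 e2 is a smooth point of the conic; the other
    points are again limits along explicit curves ([dense_cover]).  They exist
    because in characteristic 2 a shift of d1, d2 by multiples of t changes the
    squares d1^2, d2^2 only by multiples of t^2.

    Closedness in the Zariski topology is tested on points over all extension
    fields.  Hence density in projective space is checked at its generic point
    ([proj_space_dense]), and limits are points over K(t) specialized at t = 0
    ([specialize]). *)

(** * Quadratic forms given by matrices *)

Section Forms.
Variables (R : comNzRingType) (n : nat).
Implicit Types (A B : 'M[R]_n) (x y z : 'rV[R]_n).

Definition bil B x y : R := (x *m B *m y^T) 0 0.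
Definition qf A x : R := bil A x x.
Definition pol A x y : R := bil (A + A^T) x y.

Lemma bilDl B x y z : bil B (x + y) z = bil B x z + bil B y z.
Proof. by rewrite /bil !mulmxDl mxE. Qed.
Lemma bilDr B x y z : bil B x (y + z) = bil B x y + bil B x z.
Proof. by rewrite /bil linearD mulmxDr mxE. Qed.
Lemma bilZl B c x y : bil B (c *: x) y = c * bil B x y.
Proof. by rewrite /bil -!scalemxAl mxE. Qed.
Lemma bilZr B c x y : bil B x (c *: y) = c * bil B x y.
Proof. by rewrite /bil linearZ -scalemxAr mxE. Qed.
Lemma bil_trmx B x y : bil B^T x y = bil B y x.
Proof.
by rewrite /bil -[LHS](mxE trmx_key (fun i j => (x *m B^T *m y^T) j i)) -/(trmx _) !trmx_mul !trmxK mulmxA.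
Qed.
Lemma bil_addmx A B x y : bil (A + B) x y = bil A x y + bil B x y.
Proof. by rewrite /bil mulmxDr mulmxDl mxE. Qed.

Lemma polE A x y : pol A x y = bil A x y + bil A y x.
Proof. by rewrite /pol bil_addmx bil_trmx. Qed.
Lemma polC A x y : pol A x y = pol A y x.
Proof. by rewrite !polE addrC. Qed.
Lemma polDl A x y z : pol A (x + y) z = pol A x z + pol A y z.
Proof. exact: bilDl. Qed.
Lemma polDr A x y z : pol A x (y + z) = pol A x y + pol A x z.
Proof. exact: bilDr. Qed.
Lemma polZl A c x y : pol A (c *: x) y = c * pol A x y.
Proof. exact: bilZl. Qed.
Lemma polZr A c x y : pol A x (c *: y) = c * pol A x y.
Proof. exact: bilZr. Qed.
Lemma polNl A x y : pol A (- x) y = - pol A x y.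
Proof. by rewrite -scaleN1r polZl mulN1r. Qed.
Lemma polNr A x y : pol A x (- y) = - pol A x y.
Proof. by rewrite -scaleN1r polZr mulN1r. Qed.
Lemma pol0l A y : pol A 0 y = 0.
Proof. by rewrite -(scale0r 0) polZl mul0r. Qed.
Lemma pol0r A y : pol A y 0 = 0.
Proof. by rewrite polC pol0l. Qed.
Lemma polxx A x : pol A x x = qf A x *+ 2.
Proof. by rewrite polE -mulr2n. Qed.
Lemma qfD A x y : qf A (x + y) = qf A x + qf A y + pol A x y.
Proof. by rewrite /qf polE bilDl !bilDr; ring. Qed.
Lemma qfZ A c x : qf A (c *: x) = c ^+ 2 * qf A x.
Proof. by rewrite /qf bilZl bilZr mulrA expr2. Qed.
Lemma qfN A x : qf A (- x) = qf A x.
Proof. by rewrite -scaleN1r qfZ sqrrN expr1n mul1r. Qed.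
Lemma qf0 A : qf A 0 = 0.
Proof. by rewrite -(scale0r 0) qfZ expr0n mul0r. Qed.

End Forms.

(** Expansion rules: with them an identity between values of forms at linear
    combinations of vectors becomes a polynomial identity in scalars. *)
Definition polZE := (polDl, polDr, polZl, polZr, polNl, polNr, pol0l, pol0r).
Definition qfE := (qfD, qfZ, qfN, qf0).

Section FormsMap.
Variables (R S : comNzRingType) (f : {rmorphism R -> S}) (n : nat).
Lemma bil_map (B : 'M[R]_n) x y : bil (map_mx f B) (map_mx f x) (map_mx f y) = f (bil B x y).
Proof. by rewrite /bil map_trmx -!map_mxM mxE. Qed.
Lemma qf_map (B : 'M[R]_n) x : qf (map_mx f B) (map_mx f x) = f (qf B x).
Proof. exact: bil_map. Qed.
Lemma pol_map (B : 'M[R]_n) x y : pol (map_mx f B) (map_mx f x) (map_mx f y) = f (pol B x y).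
Proof. by rewrite /pol map_trmx -map_mxD bil_map. Qed.
End FormsMap.

(** * Field extensions containing prescribed roots *)

Section Extensions.
Variable K : fieldType.

(** Singular points are produced below from finitely many roots of polynomials,
    adjoined one at a time. *)
Lemma ext_root (p : {poly K}) : (1 < size p)%N ->
  exists (L : fieldType) (f : {rmorphism K -> L}) (r : L), root (map_poly f p) r.
Proof.
elim: {p}(size p).+1 {-2}p (ltnSn (size p)) => // N IH p; rewrite ltnS => leN sp.
have [irr|nirr] := classic (irreducible_poly p).
  have [L _ [z pz _]] := irredp_FAdjoin irr.
  by exists L, (in_alg L), z.
have [q [sq qp nqp]] : exists q : {poly K}, [/\ size q != 1%N, q %| p & ~~ (q %= p)].
  apply: NNPP => nex; apply: nirr; split=> // q sq qp.
  by apply: contraT => nqp; case: nex; exists q.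
have p0 : p != 0 by rewrite -size_poly_gt0 ltnW.
have q0 : q != 0 by apply: contraNneq p0 => q0; move: qp; rewrite q0 dvd0p.
have sq1 : (1 < size q)%N by case: (size q) sq (size_poly_gt0 q) => [|[]] //; rewrite q0.
have lt : (size q < size p)%N.
  by rewrite ltn_neqAle dvdp_leq // andbT; apply: contra nqp => /eqP e; rewrite -dvdp_size_eqp // e.
have [L [f [r rq]]] := IH q (leq_trans lt leN) sq1.
exists L, f, r; move: qp => /dvdpP [s ->]; by rewrite rmorphM rootM rq orbT.
Qed.

Lemma ext_sqrt (a : K) : exists (L : fieldType) (f : {rmorphism K -> L}) (r : L), r ^+ 2 = f a.
Proof.
have [|L [f [r]]] := @ext_root ('X^2 - a%:P).
  by rewrite size_XnsubC.
rewrite rmorphB /= map_polyXn map_polyC /= rootE !hornerE => /eqP h.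
by exists L, f, r; apply/eqP; rewrite -subr_eq0 h.
Qed.

Lemma ext_binary_quadratic (a b c : K) :
  exists (L : fieldType) (f : {rmorphism K -> L}) (s t : L),
    ((s != 0) || (t != 0)) /\ f a * s ^+ 2 + f b * (s * t) + f c * t ^+ 2 = 0.
Proof.
have [a0|a0] := eqVneq a 0.
  exists K, idfun, 1, 0; split; first by rewrite oner_eq0.
  by rewrite a0 rmorph0 expr0n !mulr0 mul0r !addr0.
pose p := a *: 'X^2 + b *: 'X + c%:P.
have sp : size p = 3.
  rewrite /p -addrA size_addl size_scale ?size_polyXn //.
  rewrite (leq_ltn_trans (size_polyD _ _)) // gtn_max (leq_ltn_trans (size_scale_leq _ _)) ?size_polyX //.
  by rewrite size_polyC; case: (c == 0).
have [|L [f [r]]] := @ext_root p; first by rewrite sp.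
rewrite /p !rmorphD /= !map_polyZ /= map_polyXn map_polyX map_polyC /= rootE !hornerE => /eqP h.
exists L, f, r, 1; split; first by rewrite oner_eq0 orbT.
by move: h; rewrite mulr1 expr1n mulr1 expr2 mulrA.
Qed.
End Extensions.

(** * Smooth pencils of quadrics *)

(** The row vector of the partial derivatives of the form at x. *)
Definition grad (R : comNzRingType) n (A : 'M[R]_n) (x : 'rV[R]_n) := x *m (A + A^T).

Lemma gradE (R : comNzRingType) n (A : 'M[R]_n) x y : pol A x y = (grad A x *m y^T) 0 0.
Proof. by []. Qed.

Lemma grad_map (R S : comNzRingType) (f : {rmorphism R -> S}) n (A : 'M[R]_n) x :
  grad (map_mx f A) (map_mx f x) = map_mx f (grad A x).
Proof. by rewrite /grad map_trmx -map_mxD -map_mxM. Qed.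

Lemma rowv_eq0 (R : comNzRingType) n (g : 'rV[R]_n) : (forall y : 'rV_n, (g *m y^T) 0 0 = 0) -> g = 0.
Proof.
move=> h; apply/rowP=> j; rewrite mxE -(h (delta_mx 0 j)).
rewrite trmx_delta mxE (bigD1 j) //= big1 ?addr0; last first.
  by move=> i ij; rewrite mxE (negPf ij) mulr0.
by rewrite mxE !eqxx mulr1.
Qed.

Section Pencils.
Variables (K : fieldType) (n : nat).
Implicit Types (A : 'M[K]_n) (x y z v w : 'rV[K]_n).

(** The Jacobian criterion.  Extensions of K are included because the singular
    points that contradict it below have coordinates that are roots of
    polynomials over K. *)
Definition smooth_pencil A1 A2 : Prop :=
  forall (L : fieldType) (f : {rmorphism K -> L}) (x : 'rV[L]_n) (s t : L), x != 0 ->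
    qf (map_mx f A1) x = 0 -> qf (map_mx f A2) x = 0 ->
    s *: grad (map_mx f A1) x + t *: grad (map_mx f A2) x = 0 -> s = 0 /\ t = 0.

Lemma indep2P x y : reflect (forall a b, a *: x + b *: y = 0 -> a = 0 /\ b = 0)
  (row_free (col_mx x y)).
Proof.
apply: (iffP idP) => [/row_freeP[B hB] a b h|h].
  have : row_mx a%:M b%:M *m col_mx x y = 0 by rewrite mul_row_col !mul_scalar_mx.
  move=> /(congr1 (mulmx^~ B)); rewrite /= -mulmxA hB mulmx1 mul0mx => e.
  have [/matrixP/(_ 0 0) ea /matrixP/(_ 0 0) eb] : a%:M = 0 :> 'M_1 /\ b%:M = 0 :> 'M_1.
    by apply/eq_row_mx; rewrite e row_mx0.
  by move: ea eb; rewrite !mxE !mulr1n.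
rewrite -kermx_eq0; apply/eqP/row_matrixP => i; rewrite row0.
have : row i (kermx (col_mx x y)) *m col_mx x y = 0 by rewrite -row_mul mulmx_ker row0.
move: (row i _) => u; rewrite -[u]hsubmxK mul_row_col.
rewrite [lsubmx u]mx11_scalar [rsubmx u]mx11_scalar !mul_scalar_mx => /h[-> ->].
by rewrite !raddf0 row_mx0.
Qed.

Lemma indep3P x y z : row_free (col_mx x (col_mx y z)) <->
  (forall a b c, a *: x + b *: y + c *: z = 0 -> [/\ a = 0, b = 0 & c = 0]).
Proof.
split=> [/row_freeP[B hB] a b c h|h].
  have : row_mx a%:M (row_mx b%:M c%:M) *m col_mx x (col_mx y z) = 0.
    by rewrite !mul_row_col !mul_scalar_mx addrA.
  move=> /(congr1 (mulmx^~ B)); rewrite /= -mulmxA hB mulmx1 mul0mx => e.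
  have [/matrixP/(_ 0 0) ea eb] : a%:M = 0 :> 'M_1 /\ row_mx b%:M c%:M = 0 :> 'rV_(1+1).
    by apply/eq_row_mx; rewrite e row_mx0.
  have [/matrixP/(_ 0 0) {}eb /matrixP/(_ 0 0) ec] : b%:M = 0 :> 'M_1 /\ c%:M = 0 :> 'M_1.
    by apply/eq_row_mx; rewrite eb row_mx0.
  by move: ea eb ec; rewrite !mxE !mulr1n.
rewrite -kermx_eq0; apply/eqP/row_matrixP => i; rewrite row0.
have : row i (kermx (col_mx x (col_mx y z))) *m col_mx x (col_mx y z) = 0.
  by rewrite -row_mul mulmx_ker row0.
move: (row i _) => u; rewrite -[u]hsubmxK mul_row_col -[rsubmx u]hsubmxK mul_row_col.
rewrite [lsubmx u]mx11_scalar [lsubmx (rsubmx u)]mx11_scalar [rsubmx (rsubmx u)]mx11_scalar.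
rewrite !mul_scalar_mx addrA => /h[-> -> ->].
by rewrite !raddf0 !row_mx0.
Qed.

(** Linear duality: used to turn the absence of a tangent vector with a given
    property into a linear relation between gradients, hence a singular point. *)
Lemma span2_or_separated (g1 g2 h : 'rV[K]_n) :
  (exists s t, h = s *: g1 + t *: g2) \/
  (exists y : 'rV_n, [/\ (g1 *m y^T) 0 0 = 0, (g2 *m y^T) 0 0 = 0 & (h *m y^T) 0 0 != 0]).
Proof.
case: (boolP (h <= col_mx g1 g2)%MS) => [/submxP[D ->]|].
  left; rewrite -[D]hsubmxK mul_row_col.
  by exists (lsubmx D 0 0), (rsubmx D 0 0); rewrite -!mul_scalar_mx -!mx11_scalar.
rewrite submxE => hn; right.
have [j hj] : exists j, (h *m cokermx (col_mx g1 g2)) 0 j != 0.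
  apply: NNPP => nex; case/negP: hn; apply/eqP/rowP => j.
  by rewrite [RHS]mxE; apply/eqP; apply: contraT => hj; case: nex; exists j.
exists (col j (cokermx (col_mx g1 g2)))^T; rewrite trmxK.
have := mulmx_coker (col_mx g1 g2); rewrite mul_col_mx -col_mx0 => /eq_col_mx[e1 e2].
rewrite colE !(mulmxA _ (cokermx _)) e1 e2 !mul0mx -colE ![in X in [/\ X, _ & _]]mxE; split=> //; by rewrite mxE.
Qed.
End Pencils.

Lemma dot_comb (R : comNzRingType) n s t (g h : 'rV[R]_n) (y : 'rV[R]_n) :
  ((s *: g + t *: h) *m y^T) 0 0 = s * (g *m y^T) 0 0 + t * (h *m y^T) 0 0.
Proof. by rewrite mulmxDl -!scalemxAl !mxE. Qed.

Lemma rank1_factor (K : fieldType) (a b c d : K) : a * d - b * c = 0 ->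
  exists r1 r2 s1 s2, [/\ a = r1 * s1, b = r1 * s2, c = r2 * s1 & d = r2 * s2].
Proof.
move=> /eqP; rewrite subr_eq0 => /eqP h.
have [a0|a0] := eqVneq a 0; last first.
  exists a, c, 1, (b / a); rewrite !mulr1; split=> //; first by rewrite mulrC divfK.
  by apply: (mulfI a0); rewrite h; field.
move: h; rewrite a0 mul0r => /esym/eqP; rewrite mulf_eq0 => /orP[/eqP ->|/eqP ->].
  by exists 0, 1, c, d; rewrite !mul0r !mul1r.
by exists b, d, 0, 1; rewrite !mulr0 !mulr1.
Qed.

Lemma linear_dep3 (K : fieldType) (a b c d p q : K) : exists x y z,
  [/\ [|| x != 0, y != 0 | z != 0], x * a + y * c + z * p = 0 & x * b + y * d + z * q = 0].
Proof.
pose u : 'rV[K]_(1+1) := row_mx a%:M b%:M; pose v : 'rV[K]_(1+1) := row_mx c%:M d%:M.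
pose w : 'rV[K]_(1+1) := row_mx p%:M q%:M.
have : ~~ row_free (col_mx u (col_mx v w)).
  by rewrite /row_free neq_ltn ltnS rank_leq_col.
rewrite -kermx_eq0 => /rowV0Pn[r /sub_kermxP]; rewrite -[r]hsubmxK -[rsubmx r]hsubmxK.
rewrite [lsubmx r]mx11_scalar [lsubmx (rsubmx r)]mx11_scalar [rsubmx (rsubmx r)]mx11_scalar.
move: (lsubmx r 0 0) (lsubmx (rsubmx r) 0 0) (rsubmx (rsubmx r) 0 0) => x y z.
rewrite !mul_row_col !mul_scalar_mx => e n; exists x, y, z; split.
- apply: contraNT n; rewrite !negb_or !negbK => /and3P[/eqP -> /eqP -> /eqP ->].
  by rewrite !raddf0 !row_mx0.
- move: e; rewrite /u /v /w !scale_row_mx !add_row_mx -[0 in RHS](@row_mx0 _ 1 1 1) => /eq_row_mx[e1 e2].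
  by have := congr1 (fun m : 'M_1 => m 0 0) e1; rewrite !mxE !mulr1n addrA.
move: e; rewrite /u /v /w !scale_row_mx !add_row_mx -[0 in RHS](@row_mx0 _ 1 1 1) => /eq_row_mx[e1 e2].
by have := congr1 (fun m : 'M_1 => m 0 0) e2; rewrite !mxE !mulr1n addrA.
Qed.

Lemma proportional2 (K : fieldType) (s t c d : K) : (s != 0) || (t != 0) -> t * c = s * d ->
  exists eta, c = eta * s /\ d = eta * t.
Proof.
move=> st e; have [s0|s0] := eqVneq s 0.
  have t0 : t != 0 by move: st; rewrite s0 eqxx.
  exists (d / t); rewrite divfK //; split=> //; apply: (mulfI t0).
  by rewrite e s0 mulr0 mulr0 mul0r.
exists (c / s); rewrite divfK //; split=> //; apply: (mulfI s0).
by rewrite -e; field.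
Qed.

Section Smooth.
Variables (n : nat).

Lemma smooth_pencil_ext (K L : fieldType) (f : {rmorphism K -> L}) (A1 A2 : 'M[K]_n) :
  smooth_pencil A1 A2 -> smooth_pencil (map_mx f A1) (map_mx f A2).
Proof.
move=> h M g x s t; rewrite -!map_mx_comp; exact: (h M (g \o f)).
Qed.

Lemma map_idfun (K : fieldType) m p (A : 'M[K]_(m, p)) : map_mx idfun A = A.
Proof. by apply/matrixP => i j; rewrite mxE. Qed.

Variable (K : fieldType).
Variables (A1 A2 : 'M[K]_n).
Hypothesis sm : smooth_pencil A1 A2.

Lemma smoothP (x : 'rV[K]_n) s t : x != 0 -> qf A1 x = 0 -> qf A2 x = 0 ->
  (forall y, s * pol A1 x y + t * pol A2 x y = 0) -> s = 0 /\ t = 0.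
Proof.
move=> x0 q1 q2 h; apply: (sm (f := idfun) x0); rewrite ?map_idfun //.
apply: rowv_eq0 => y; rewrite mulmxDl -!scalemxAl.
by have := h y; rewrite !gradE !mxE.
Qed.

(** If x' had the tangent space of x, then the gradients at x' would be a 2 x 2
    matrix times the gradients at x.  For an eigenvector (s, t) of the matrix
    with eigenvalue l, the point x' - l x is a vertex of the quadric
    s q1 + t q2 and lies on X. *)
Lemma tangent_distinct (x x' : 'rV[K]_n) :
  qf A1 x = 0 -> qf A2 x = 0 -> qf A1 x' = 0 -> qf A2 x' = 0 ->
  pol A1 x x' = 0 -> pol A2 x x' = 0 -> row_free (col_mx x x') ->
  exists y, [/\ pol A1 x y = 0, pol A2 x y = 0 & (pol A1 x' y != 0) || (pol A2 x' y != 0)].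
Proof.
move=> q1 q2 q1' q2' p1 p2 fr.
have [[a [b e1]]|[y [h1 h2 h3]]] := span2_or_separated (grad A1 x) (grad A2 x) (grad A1 x'); last first.
  by exists y; split=> //; rewrite gradE h3.
have [[c [d e2]]|[y [h1 h2 h3]]] := span2_or_separated (grad A1 x) (grad A2 x) (grad A2 x'); last first.
  by exists y; split=> //; rewrite [pol A2 _ _]gradE h3 orbT.
exfalso.
(* This binary form vanishes at the left eigenvectors of (a, b; c, d). *)
have [L [f [s [t [st h]]]]] := ext_binary_quadratic b (d - a) (- c).
have [l [l1 l2]] : exists l, s * f a + t * f c = l * s /\ s * f b + t * f d = l * t.
  rewrite !rmorphB !rmorphN /= in h.
  have [s0|s0] := eqVneq s 0.
    have t0 : t != 0 by move: st; rewrite s0 eqxx.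
    exists (f d); rewrite s0 !mul0r !add0r !mulr0; split; last by rewrite mulrC.
    move: h; rewrite s0 expr0n /= mul0r !mulr0 !add0r => /eqP.
    by rewrite mulNr oppr_eq0 mulf_eq0 expf_eq0 /= (negPf t0) orbF => /eqP->; rewrite mulr0.
  exists ((s * f a + t * f c) / s); rewrite divfK //; split=> //.
  apply: (mulfI s0); rewrite mulrA [s * (_ / _)]mulrC divfK //.
  by apply/eqP; rewrite -subr_eq0 -[X in _ == X]h; apply/eqP; ring.
pose X := map_mx f x; pose X' := map_mx f x'.
have z0 : X' - l *: X != 0.
  apply/eqP => e; have := row_free_map f (col_mx x x'); rewrite fr map_col_mx => /indep2P.
  move=> /(_ (- l) 1); rewrite scaleNr scale1r addrC => /(_ e)[_ /eqP].
  by rewrite oner_eq0.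
have qX (A : 'M[K]_n) : qf A x = 0 -> qf A x' = 0 -> pol A x x' = 0 -> qf (map_mx f A) (X' - l *: X) = 0.
  by move=> u1 u2 u3; rewrite !(qfE, polZE) !qf_map polC pol_map u1 u2 u3 !rmorph0; ring.
have [] := sm (f := f) (s := s) (t := t) z0 (qX _ q1 q1' p1) (qX _ q2 q2' p2).
  rewrite /grad !mulmxBl -!scalemxAl -!/(grad _ _) !grad_map e1 e2 !(map_mxD, map_mxZ).
  move: (grad A1 x) (grad A2 x) => g1 g2; apply/rowP => j; rewrite !mxE.
  transitivity ((s * f a + t * f c - l * s) * f (g1 0 j) + (s * f b + t * f d - l * t) * f (g2 0 j)); first by ring.
  by rewrite l1 l2 !subrr !mul0r addr0.
by move=> s0 t0; move: st; rewrite s0 t0 eqxx.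
Qed.

End Smooth.

Definition pencil_kernel (R : comNzRingType) n (A1 A2 : 'M[R]_n) s t v := s *: grad A1 v + t *: grad A2 v = 0.

Lemma pencil_kernel_pol (R : comNzRingType) n (A1 A2 : 'M[R]_n) s t v : pencil_kernel A1 A2 s t v ->
  forall y, s * pol A1 v y + t * pol A2 v y = 0.
Proof.
move=> gv y; have := congr1 (fun g => (g *m y^T) 0 0) gv.
by rewrite !gradE mulmxDl -!scalemxAl mul0mx !mxE.
Qed.

Lemma pol_pencil_kernel (R : comNzRingType) n (A1 A2 : 'M[R]_n) s t v :
  (forall y, s * pol A1 v y + t * pol A2 v y = 0) -> pencil_kernel A1 A2 s t v.
Proof.
move=> h; apply: rowv_eq0 => y; have := h y.
by rewrite !gradE mulmxDl -!scalemxAl !mxE.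
Qed.

Lemma pencil_kernel_comb (R : comNzRingType) n (A1 A2 : 'M[R]_n) s t v w a b :
  pencil_kernel A1 A2 s t v -> pencil_kernel A1 A2 s t w -> pencil_kernel A1 A2 s t (a *: v + b *: w).
Proof.
move=> /pencil_kernel_pol kv /pencil_kernel_pol kw; apply: pol_pencil_kernel => y; rewrite !polZE.
transitivity (a * (s * pol A1 v y + t * pol A2 v y) + b * (s * pol A1 w y + t * pol A2 w y)); first by ring.
by rewrite kv kw !mulr0 addr0.
Qed.

Lemma pencil_kernel_map (R S : comNzRingType) (f : {rmorphism R -> S}) n (A1 A2 : 'M[R]_n) s t v :
  pencil_kernel A1 A2 s t v -> pencil_kernel (map_mx f A1) (map_mx f A2) (f s) (f t) (map_mx f v).
Proof. by rewrite /pencil_kernel !grad_map -!map_mxZ -map_mxD => ->; rewrite map_mx0. Qed.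

Section Kernel.
Variable n : nat.

(** The next lemmas bound the radical of each member s q1 + t q2: its polar form
    has no three independent vectors in the kernel.  Two kernel vectors on which
    the member vanishes span a line on it, and the line meets another quadric
    of the pencil, in a singular point of X. *)
Lemma kernel2_false (K : fieldType) (A1 A2 : 'M[K]_n) (sm : smooth_pencil A1 A2) s t v w :
  (s != 0) || (t != 0) -> row_free (col_mx v w) ->
  pencil_kernel A1 A2 s t v -> pencil_kernel A1 A2 s t w ->
  s * qf A1 v + t * qf A2 v = 0 -> s * qf A1 w + t * qf A2 w = 0 -> False.
Proof.
move=> st fr gv gw qv qw.
have kv := pencil_kernel_pol gv.
(* The boolean selects a quadric of the pencil other than the given member. *)
have [i [L [f [a [b [ab h]]]]]] : exists i : bool, exists (L : fieldType) (f : {rmorphism K -> L}) (a b : L),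
    ((a != 0) || (b != 0)) /\ (if i then (s != 0) else (t != 0)) /\
    qf (map_mx f (if i then A2 else A1)) (a *: map_mx f v + b *: map_mx f w) = 0.
  have H (A : 'M[K]_n) : exists (L : fieldType) (f : {rmorphism K -> L}) (a b : L),
    ((a != 0) || (b != 0)) /\ qf (map_mx f A) (a *: map_mx f v + b *: map_mx f w) = 0.
    have [L [f [a [b [ab h]]]]] := ext_binary_quadratic (qf A v) (pol A v w) (qf A w).
    exists L, f, a, b; split=> //; rewrite -[RHS]h !(qfE, polZE) !qf_map pol_map; ring.
  have [s0|s0] := eqVneq s 0.
    exists false; have [L [f [a [b [ab h]]]]] := H A1; exists L, f, a, b; split=> //; split=> //.
    by move: st; rewrite s0 eqxx.
  by exists true; have [L [f [a [b [ab h]]]]] := H A2; exists L, f, a, b.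
case: h => sti h.
pose X := a *: map_mx f v + b *: map_mx f w.
have X0 : X != 0.
  apply/eqP => e; have := row_free_map f (col_mx v w); rewrite fr map_col_mx => /indep2P.
  by move=> /(_ a b e)[a0 b0]; move: ab; rewrite a0 b0 eqxx.
have qX : f s * qf (map_mx f A1) X + f t * qf (map_mx f A2) X = 0.
  rewrite !(qfE, polZE) !qf_map !pol_map.
  transitivity (a ^+ 2 * f (s * qf A1 v + t * qf A2 v) + b ^+ 2 * f (s * qf A1 w + t * qf A2 w)
     + a * b * f (s * pol A1 v w + t * pol A2 v w)).
    by rewrite !rmorphD !rmorphM /=; ring.
  by rewrite qv qw kv rmorph0; ring.
have [q1 q2] : qf (map_mx f A1) X = 0 /\ qf (map_mx f A2) X = 0.
  case: i sti h qX => sti -> /eqP; rewrite mulr0 ?addr0 ?add0r mulf_eq0 fmorph_eq0 (negPf sti) /=;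
  by move=> /eqP.
have [] := sm L f X (f s) (f t) X0 q1 q2 (pencil_kernel_comb a b (pencil_kernel_map f gv) (pencil_kernel_map f gw)).
by move=> /eqP s0 /eqP t0; move: st; rewrite !fmorph_eq0 in s0 t0; rewrite s0 t0.
Qed.

(** On the kernel the member of the pencil is a diagonal form, so any two kernel
    vectors have a combination on which it vanishes.  Doing this once with
    v2, v3 and, in the next lemma, once with v1, v2 reduces to two vectors. *)
Lemma kernel3_aux (K : fieldType) (A1 A2 : 'M[K]_n) (sm : smooth_pencil A1 A2) s t v1 v2 v3 :
  (s != 0) || (t != 0) -> row_free (col_mx v1 (col_mx v2 v3)) ->
  pencil_kernel A1 A2 s t v1 -> pencil_kernel A1 A2 s t v2 -> pencil_kernel A1 A2 s t v3 ->
  s * qf A1 v1 + t * qf A2 v1 = 0 -> False.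
Proof.
move=> st fr k1 k2 k3 q1.
have [L [f [a [b [ab h]]]]] := ext_binary_quadratic (s * qf A1 v2 + t * qf A2 v2) 0 (s * qf A1 v3 + t * qf A2 v3).
apply: (@kernel2_false L _ _ (smooth_pencil_ext (f := f) sm) (f s) (f t) (map_mx f v1) (a *: map_mx f v2 + b *: map_mx f v3)).
- by rewrite !fmorph_eq0.
- have := row_free_map f (col_mx v1 (col_mx v2 v3)); rewrite fr !map_col_mx => /indep3P fr'.
  apply/indep2P => x y e; have [|-> ya yb] := fr' x (y * a) (y * b).
    by rewrite -[RHS]e scalerDr !scalerA addrA.
  split=> //; apply/eqP; move: ya yb => /eqP; rewrite mulf_eq0 => /orP[//|/eqP a0] /eqP.
  by rewrite mulf_eq0; move: ab; rewrite a0 eqxx /= => /negPf ->; rewrite orbF.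
- exact: pencil_kernel_map.
- by apply: pencil_kernel_comb; apply: pencil_kernel_map.
- by rewrite !qf_map -!rmorphM -rmorphD q1 rmorph0.
have := congr1 f (pencil_kernel_pol k2 v3); rewrite rmorphD !rmorphM rmorph0 => p23.
rewrite !(qfE, polZE) !qf_map !pol_map.
rewrite [RHS](_ : 0 = 0 + a * b * 0); last by ring.
rewrite -{1}h -p23 !rmorphD !rmorphM rmorph0 /=.
ring.
Qed.

Lemma kernel3_false (K : fieldType) (A1 A2 : 'M[K]_n) (sm : smooth_pencil A1 A2) s t v1 v2 v3 :
  (s != 0) || (t != 0) -> row_free (col_mx v1 (col_mx v2 v3)) ->
  pencil_kernel A1 A2 s t v1 -> pencil_kernel A1 A2 s t v2 -> pencil_kernel A1 A2 s t v3 -> False.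
Proof.
move=> st fr k1 k2 k3.
have [L [f [a [b [ab h]]]]] := ext_binary_quadratic (s * qf A1 v1 + t * qf A2 v1) 0 (s * qf A1 v2 + t * qf A2 v2).
have sm' := smooth_pencil_ext (f := f) sm.
have st' : (f s != 0) || (f t != 0) by rewrite !fmorph_eq0.
have := row_free_map f (col_mx v1 (col_mx v2 v3)); rewrite fr !map_col_mx => /indep3P fr'.
have kg := pencil_kernel_comb a b (pencil_kernel_map f k1) (pencil_kernel_map f k2).
have qg : f s * qf (map_mx f A1) (a *: map_mx f v1 + b *: map_mx f v2)
        + f t * qf (map_mx f A2) (a *: map_mx f v1 + b *: map_mx f v2) = 0.
  have := congr1 f (pencil_kernel_pol k1 v2); rewrite rmorphD !rmorphM rmorph0 => p12.
  rewrite !(qfE, polZE) !qf_map !pol_map.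
  rewrite [RHS](_ : 0 = 0 + a * b * 0); last by ring.
  rewrite -{1}h -p12 !rmorphD !rmorphM rmorph0 /=.
  ring.
have [a0|a0] := eqVneq a 0.
  apply: (kernel3_aux sm' st' _ kg (pencil_kernel_map f k1) (pencil_kernel_map f k3) qg).
  have b0 : b != 0 by move: ab; rewrite a0 eqxx.
  apply/indep3P => x y z e; have [|e1 /eqP e2 e3] := fr' (x * a + y) (x * b) z.
    by rewrite -[RHS]e scalerDr !scalerA scalerDl; congr (_ + _); rewrite addrAC.
  move: e2; rewrite mulf_eq0 (negPf b0) orbF => /eqP e2.
  by move: e1; rewrite e2 mul0r add0r.
apply: (kernel3_aux sm' st' _ kg (pencil_kernel_map f k2) (pencil_kernel_map f k3) qg).
apply/indep3P => x y z e; have [|/eqP e1 e2 e3] := fr' (x * a) (x * b + y) z.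
  by rewrite -[RHS]e scalerDr !scalerA scalerDl !addrA.
move: e1; rewrite mulf_eq0 (negPf a0) orbF => /eqP e1.
by move: e2; rewrite e1 mul0r add0r.
Qed.
End Kernel.

(** * Evaluation of polynomials and specialization *)

Section Eval.
Variables (n : nat) (R S : comNzRingType) (f : {rmorphism R -> S}).

(** Values in a ring, and not only in a field, are needed for curves: they are
    computed over the ring K[t] before passing to K(t). *)
Definition ev (g : {mpoly R[n]}) (x : 'rV[S]_n) : S := (map_mpoly f g).@[fun i => x 0 i].

Definition evx (x : 'rV[S]_n) : {mpoly R[n]} -> S := meval (fun i => x 0 i) \o map_mpoly f.
HB.instance Definition _ x := GRing.RMorphism.on (evx x).

Lemma evxE x g : evx x g = ev g x. Proof. by []. Qed.
Lemma evxC x c : evx x c%:MP = f c.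
Proof. by rewrite /evx /= map_mpolyC mevalC. Qed.
Lemma evxX x i : evx x 'X_i = x 0 i.
Proof. by rewrite /evx /= map_mpolyX mevalXU. Qed.

Lemma evE g x : ev g x = \sum_(m <- msupp g) f g@_m * \prod_i x 0 i ^+ m i.
Proof.
rewrite -evxE {1}[g]mpolyE rmorph_sum; apply: eq_bigr => m _.
rewrite -mul_mpolyC rmorphM /= evxC; congr (_ * _).
by rewrite /evx /= map_mpolyX mevalX.
Qed.

Lemma ev_homog e g c x : g \is e.-homog -> ev g (c *: x) = c ^+ e * ev g x.
Proof.
move=> /dhomogP hg; rewrite !evE big_distrr /=; rewrite !big_seq; apply: eq_bigr => m /hg hm.
have {hm}<- : mdeg m = e by exact: hm.
rewrite mulrCA; congr (_ * _); rewrite mdegE expr_sum -big_split /=.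
by apply: eq_bigr => i _; rewrite mxE exprMn.
Qed.

(** The vector of indeterminates.  A vector expression in it with coefficients
    [constmx] is the tuple of polynomials that defines a rational map. *)
Definition vecX : 'rV[{mpoly R[n]}]_n := \row_j 'X_j.
Definition constmx p q (A : 'M[R]_(p, q)) : 'M[{mpoly R[n]}]_(p, q) := map_mx (@mpolyC n R) A.
Lemma map_evxC x p q (A : 'M[R]_(p, q)) : map_mx (evx x) (constmx A) = map_mx f A.
Proof. by apply/matrixP => i j; rewrite !mxE evxC. Qed.
Lemma map_evxX x : map_mx (evx x) vecX = x.
Proof. by apply/rowP => i; rewrite !mxE evxX. Qed.
End Eval.
Arguments vecX {n R}.
Arguments constmx n {R p q} A.

Lemma ev_eq n (R S : comNzRingType) (f f' : {rmorphism R -> S}) (g : {mpoly R[n]}) x :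
  f =1 f' -> ev f g x = ev f' g x.
Proof. by move=> e; rewrite !evE; apply: eq_bigr => m _; rewrite e. Qed.

Lemma ev_morph n (R S T : comNzRingType) (f : {rmorphism R -> S}) (h : {rmorphism S -> T}) (g : {mpoly R[n]}) x :
  h (ev f g x) = ev (h \o f) g (map_mx h x).
Proof.
rewrite !evE rmorph_sum; apply: eq_bigr => m _; rewrite rmorphM rmorph_prod; congr (_ * _).
by apply: eq_bigr => i _; rewrite rmorphXn mxE.
Qed.

Lemma ev_vecX n (R : comNzRingType) (g : {mpoly R[n]}) : ev (@mpolyC n R) g vecX = g.
Proof.
rewrite evE [RHS]mpolyE; apply: eq_bigr => m _; rewrite mul_mpolyC; congr (_ *: _).
by rewrite mpolyXE_id; apply: eq_bigr => i _; rewrite mxE.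
Qed.

Definition polyF (K : fieldType) : K -> {fraction {poly K}} := @FracField.tofrac {poly K} \o polyC.
HB.instance Definition _ K := GRing.RMorphism.on (@polyF K).

Notation at0 := (horner_eval 0).

(** The closed condition g = 0 passes from the generic point of the curve c x
    to the point x(0).  Since g is homogeneous, the factor c, a power of t in
    the applications, may be removed first. *)
Lemma specialize (k K : fieldType) (f : {rmorphism k -> K}) n (g : {mpoly k[n]}) e
    (c : {poly K}) (x : 'rV[{poly K}]_n) :
  g \is e.-homog -> c != 0 ->
  ev (@polyF K \o f) g (map_mx (@FracField.tofrac {poly K}) (c *: x)) = 0 ->
  ev f g (map_mx at0 x) = 0.
Proof.
move=> hg c0 h.
have : ev (polyC \o f) g x = 0.
  have : ev (polyC \o f) g (c *: x) = 0.
    apply/eqP; rewrite -tofrac_eq0 ev_morph; apply/eqP; rewrite -[RHS]h; exact: ev_eq.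
  by rewrite (ev_homog _ _ _ hg) => /eqP; rewrite mulf_eq0 expf_eq0 (negPf c0) andbF => /eqP.
move=> /(congr1 at0); rewrite rmorph0 ev_morph => h0.
by rewrite -[RHS]h0; apply: ev_eq => a /=; rewrite /horner_eval hornerC.
Qed.

(** The property holds for the products of two variables and is linear in q.
    The derivatives are carried along to identify the Jacobian matrix. *)
Lemma quadratic_form_mx (R : comNzRingType) n (q : {mpoly R[n]}) : q \is 2.-homog ->
  exists A : 'M[R]_n, q = qf (constmx n A) vecX /\ forall j, q^`M(j) = (grad (constmx n A) vecX) 0 j.
Proof.
have submm (a : 'X_{1..n}) : (a - a = 0)%MM by apply/mnmP => b; rewrite mnmBE mnm0E subnn.
pose P (q : {mpoly R[n]}) := exists A : 'M[R]_n, q = qf (constmx n A) vecX /\ forall j, q^`M(j) = (grad (constmx n A) vecX) 0 j.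
have PD p1 p2 : P p1 -> P p2 -> P (p1 + p2).
  move=> [A1 [e1 d1]] [A2 [e2 d2]]; exists (A1 + A2); split=> [|j].
    by rewrite e1 e2 /constmx map_mxD /qf bil_addmx.
  rewrite mderivD d1 d2 /grad /constmx map_mxD [(map_mx _ A1 + _)^T]raddfD /= addrACA.
  by rewrite [in RHS]mulmxDr [in RHS]mxE.
have PZ c p1 : P p1 -> P (c *: p1).
  move=> [A1 [e1 d1]]; exists (c *: A1); split=> [|j].
    by rewrite /constmx map_mxZ /qf /bil -scalemxAr -scalemxAl mxE [in LHS]e1 mul_mpolyC.
  by rewrite mderivZ d1 /grad /constmx map_mxZ [(_ *: _)^T]linearZ /= -scalerDr -scalemxAr [in RHS]mxE mul_mpolyC.
have PX i l : P ('X_i * 'X_l).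
  have dE : constmx n (delta_mx i l : 'M[R]_n) = delta_mx i l.
    by apply/matrixP => a b; rewrite !mxE rmorph_nat.
  have mE a b : vecX *m (delta_mx a b : 'M[{mpoly R[n]}]_n) = 'X_a *: delta_mx 0 b.
    apply/rowP => c; rewrite !mxE (bigD1 a) //= big1 ?addr0 => [|d da].
      by rewrite !mxE eqxx.
    by rewrite !mxE (negPf da) mulr0.
  exists (delta_mx i l); split=> [|j]; rewrite dE.
    rewrite /qf /bil mE -scalemxAl mxE; congr (_ * _).
    rewrite mxE (bigD1 l) //= big1 ?addr0 => [|d da].
      by rewrite !mxE !eqxx mul1r.
    by rewrite !mxE (negPf da) mul0r.
  rewrite /grad trmx_delta mulmxDr !mE !mxE mderivM !mderivX.
  rewrite !mnm1E eqxx /= [i == j]eq_sym [l == j]eq_sym addrC.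
  congr (_ + _).
    have [->|/negPf ne] := eqVneq j i; last by rewrite scale0r mul0r mulr0.
    by rewrite submm mpolyX0 scale1r mul1r mulr1.
  have [->|/negPf ne] := eqVneq j l; last by rewrite scale0r !mulr0.
  by rewrite submm mpolyX0 scale1r.
move=> /dhomogP hq; rewrite -/(P q) [q]mpolyE big_seq.
apply: (big_ind P) => [|//|m /hq dm].
  exists 0; rewrite /constmx map_mx0; split=> [|j]; first by rewrite /qf /bil mulmx0 mul0mx mxE.
  by rewrite mderiv0 /grad trmx0 addr0 mulmx0 mxE.
apply: PZ.
have [i mi] : exists i, m i != 0%N.
  apply: NNPP => nex; suff: mdeg m = 0%N by rewrite dm.
  rewrite mdegE big1 // => i _; apply/eqP; apply: contraT => h; case: nex; by exists i.
have le : (U_(i) <= m)%MM.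
  by apply/mnm_lepP => l; rewrite mnm1E; case: (i =P l) => [<-|//]; rewrite lt0n.
have /mdeg1P[l /eqP e] : mdeg (m - U_(i))%MM == 1%N.
  by have := mdegD (m - U_(i)) U_(i); rewrite submK // mdeg1 dm addn1 => -[->].
by rewrite -(submK le) e mpolyXD.
Qed.

Lemma ev_qf (R S : comNzRingType) (f : {rmorphism R -> S}) n (A : 'M[R]_n) x :
  ev f (qf (constmx n A) vecX) x = qf (map_mx f A) x.
Proof. by rewrite -evxE -qf_map map_evxC map_evxX. Qed.

Lemma ev_grad (R S : comNzRingType) (f : {rmorphism R -> S}) n (A : 'M[R]_n) x j :
  ev f (grad (constmx n A) vecX 0 j) x = grad (map_mx f A) x 0 j.
Proof.
rewrite -evxE -[LHS](mxE map_mx_key (fun i j => evx f x ((grad (constmx n A) vecX) i j)) 0 j).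
by rewrite -/(map_mx _ _) -grad_map map_evxC map_evxX.
Qed.

(** * Projection from a line on the base locus *)

Section Projection.
Variables (R : comNzRingType) (n : nat) (A1 A2 : 'M[R]_n) (u1 u2 : 'rV[R]_n).
Implicit Types v x y : 'rV[R]_n.

(** For c = v + a u1 + b u2 the equations q1 = q2 = 0 are linear in (a, b), by
    vanishing of the forms on the line through u1 and u2.  Their determinant is
    [contact v], and [unproject v] is the solution given by Cramer's rule,
    multiplied by the determinant.  Both depend only on v modulo the line. *)
Definition contact v := pol A1 u1 v * pol A2 u2 v - pol A1 u2 v * pol A2 u1 v.
Definition contact_polar x y := pol A1 u1 x * pol A2 u2 y + pol A1 u1 y * pol A2 u2 x
  - pol A1 u2 x * pol A2 u1 y - pol A1 u2 y * pol A2 u1 x.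
Definition cramer1 v y := pol A2 u2 v * qf A1 y - pol A1 u2 v * qf A2 y.
Definition cramer2 v y := pol A1 u1 v * qf A2 y - pol A2 u1 v * qf A1 y.
Definition unproject v := contact v *: v - (cramer1 v v *: u1 + cramer2 v v *: u2).

Lemma contactD x y c : contact (x + c *: y) = contact x + c * contact_polar x y + c ^+ 2 * contact y.
Proof. rewrite /contact /contact_polar !polZE; ring. Qed.
Lemma contactZ c x : contact (c *: x) = c ^+ 2 * contact x.
Proof. rewrite /contact !polZE; ring. Qed.

(** Vectors of the affine cone over the base locus X of the pencil. *)
Definition in_base x := qf A1 x = 0 /\ qf A2 x = 0.

Lemma unproject_base x : in_base x -> unproject x = contact x *: x.
Proof. by case=> q1 q2; rewrite /unproject /cramer1 /cramer2 q1 q2 !mulr0 subrr !scale0r addr0 subr0. Qed.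

Definition is_line := [/\ in_base u1, in_base u2, pol A1 u1 u2 = 0 & pol A2 u1 u2 = 0].
Hypothesis line : is_line.

Lemma pol_line (A : 'M[R]_n) : A = A1 \/ A = A2 ->
  [/\ pol A u1 u1 = 0, pol A u1 u2 = 0, pol A u2 u1 = 0 & pol A u2 u2 = 0].
Proof.
by case: line => [[h1 h2] [h3 h4] h5 h6] [] ->; rewrite !polxx [pol _ u2 u1]polC ?h1 ?h2 ?h3 ?h4 ?h5 ?h6 ?mul0rn.
Qed.

Lemma pol_line_translate (A : 'M[R]_n) a b v : A = A1 \/ A = A2 ->
  pol A u1 (v + (a *: u1 + b *: u2)) = pol A u1 v /\ pol A u2 (v + (a *: u1 + b *: u2)) = pol A u2 v.
Proof.
by move=> /pol_line[h1 h2 h3 h4]; rewrite !polZE h1 h2 h3 h4 !mulr0 !addr0.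
Qed.

Lemma contact_line_translate a b v : contact (v + (a *: u1 + b *: u2)) = contact v.
Proof.
have [e1 e2] := pol_line_translate a b v (or_introl erefl); have [e3 e4] := pol_line_translate a b v (or_intror erefl).
by rewrite /contact e1 e2 e3 e4.
Qed.

Lemma unproject_line_translate a b v : unproject (v + (a *: u1 + b *: u2)) = unproject v.
Proof.
rewrite /unproject contact_line_translate /cramer1 /cramer2.
have [-> ->] := pol_line_translate a b v (or_introl erefl); have [-> ->] := pol_line_translate a b v (or_intror erefl).
have qE (A : 'M[R]_n) : A = A1 \/ A = A2 ->
    qf A (v + (a *: u1 + b *: u2)) = qf A v + a * pol A u1 v + b * pol A u2 v.
  case: line => [[h1 h2] [h3 h4] h5 h6] [] ->;
  by rewrite !(qfE, polZE) ?h1 ?h2 ?h3 ?h4 ?h5 ?h6 ![pol _ v _]polC; ring.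
rewrite !qE; [|by right|by left].
rewrite /contact; apply/rowP => j; rewrite !mxE; ring.
Qed.

Lemma qf_unproject (A : 'M[R]_n) v : A = A1 \/ A = A2 -> qf A (unproject v) = 0.
Proof.
rewrite /unproject /contact /cramer1 /cramer2; case: line => [[h1 h2] [h3 h4] h5 h6] [] ->;
by rewrite !(qfE, polZE) ?h1 ?h2 ?h3 ?h4 ?h5 ?h6 ![pol _ v _]polC; ring.
Qed.

Lemma in_base_unproject v : in_base (unproject v).
Proof. by split; apply: qf_unproject; [left|right]. Qed.

Lemma contact_unproject v : contact (unproject v) = contact v ^+ 3.
Proof.
by rewrite {1}/unproject opprD -!scaleNr contact_line_translate contactZ -exprSr.
Qed.

End Projection.

Section ProjectionMap.
Variables (R S : comNzRingType) (f : {rmorphism R -> S}) (n : nat) (A1 A2 : 'M[R]_n) (u1 u2 : 'rV[R]_n).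
Lemma contact_map v : contact (map_mx f A1) (map_mx f A2) (map_mx f u1) (map_mx f u2) (map_mx f v) = f (contact A1 A2 u1 u2 v).
Proof. by rewrite /contact !pol_map rmorphB !rmorphM. Qed.
Lemma unproject_map v : unproject (map_mx f A1) (map_mx f A2) (map_mx f u1) (map_mx f u2) (map_mx f v)
  = map_mx f (unproject A1 A2 u1 u2 v).
Proof.
rewrite /unproject contact_map /cramer1 /cramer2 !pol_map !qf_map map_mxB map_mxD !map_mxZ.
by rewrite !rmorphB !rmorphM.
Qed.
Lemma in_base_map x : in_base A1 A2 x -> in_base (map_mx f A1) (map_mx f A2) (map_mx f x).
Proof. by case=> h1 h2; split; rewrite qf_map ?h1 ?h2 rmorph0. Qed.
Lemma is_line_map : is_line A1 A2 u1 u2 -> is_line (map_mx f A1) (map_mx f A2) (map_mx f u1) (map_mx f u2).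
Proof. by case=> h1 h2 h3 h4; split; rewrite ?pol_map ?h3 ?h4 ?rmorph0 //; apply: in_base_map. Qed.
End ProjectionMap.

(** * Density of the points where the contact determinant is not zero *)

Section Density.
Variables (k : fieldType) (n e : nat) (g : {mpoly k[n]}).
Hypothesis hg : g \is e.-homog.

(** The hypothesis on g from which vanishing on all of X will follow.  The
    quantification over extensions of K makes it available at the generic points
    of curves, that is, over K(t). *)
Definition vanishes_off_contact (K : fieldType) (f0 : {rmorphism k -> K}) (A1 A2 : 'M[K]_n) u1 u2 : Prop :=
  forall (L : fieldType) (f : {rmorphism K -> L}) x,
    in_base (map_mx f A1) (map_mx f A2) x ->
    contact (map_mx f A1) (map_mx f A2) (map_mx f u1) (map_mx f u2) x != 0 -> ev (f \o f0) g x = 0.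

Lemma vanishes_off_contact_ext (K L : fieldType) (f0 : {rmorphism k -> K}) (f : {rmorphism K -> L}) A1 A2 u1 u2 :
  vanishes_off_contact f0 A1 A2 u1 u2 ->
  vanishes_off_contact (f \o f0) (map_mx f A1) (map_mx f A2) (map_mx f u1) (map_mx f u2).
Proof.
move=> h M f' x; rewrite -!map_mx_comp => hx dx.
have := h M (f' \o f) x hx dx; exact.
Qed.

Section OverK.
Variables (K : fieldType) (f0 : {rmorphism k -> K}) (A1 A2 : 'M[K]_n) (u1 u2 : 'rV[K]_n).
Hypotheses (line : is_line A1 A2 u1 u2) (van : vanishes_off_contact f0 A1 A2 u1 u2).

Notation pC A := (map_mx polyC A).
Notation toF := (@FracField.tofrac {poly K}).
Notation at0 := (horner_eval (0 : K)).

Lemma at0_polyC p q (A : 'M[K]_(p, q)) : map_mx at0 (pC A) = A.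
Proof. by apply/matrixP => i j; rewrite !mxE /horner_eval hornerC. Qed.

(** At the generic point of the curve v the determinant is not zero, so g
    vanishes at its image under [unproject]; dividing by c and setting t = 0
    gives a multiple of x. *)
Lemma curve_limit (c : {poly K}) v r a x : c != 0 ->
  unproject (pC A1) (pC A2) (pC u1) (pC u2) v = c *: r ->
  contact (pC A1) (pC A2) (pC u1) (pC u2) v != 0 ->
  map_mx at0 r = a *: x -> a != 0 -> ev f0 g x = 0.
Proof.
move=> c0 hl hd hr a0.
have lineP : is_line (pC A1) (pC A2) (pC u1) (pC u2) by exact: is_line_map.
have mE p q (A : 'M[K]_(p, q)) : map_mx (@polyF K) A = map_mx toF (pC A) by rewrite -map_mx_comp.
have h : ev (@polyF K \o f0) g (map_mx toF (c *: r)) = 0.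
  apply: (van (L := {fraction {poly K}}) (f := @polyF K)); rewrite !mE.
    by apply: in_base_map; rewrite -hl; apply: in_base_unproject.
  by rewrite contact_map -hl contact_unproject // tofrac_eq0 expf_eq0.
have := specialize hg c0 h; rewrite hr (ev_homog _ _ _ hg) => /eqP.
by rewrite mulf_eq0 expf_eq0 (negPf a0) andbF => /eqP.
Qed.

(** The matrix whose determinant is [contact x] is not zero. *)
Definition contact_mx_neq0 x := [|| pol A1 u1 x != 0, pol A1 u2 x != 0, pol A2 u1 x != 0 | pol A2 u2 x != 0].

Hypothesis sm : smooth_pencil A1 A2.
Hypothesis indep : row_free (col_mx u1 u2).

Lemma poly_at0_neq0 (p : {poly K}) : p.[0] != 0 -> p != 0.
Proof. by apply: contraNneq => ->; rewrite horner0. Qed.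

(** If the determinant is zero at x but the matrix has rank one, its derivative
    along some tangent vector y at x is not zero, and unproject (x + t y) is t
    times a curve through a multiple of x.  Such a y exists: the derivative is
    the polar form, at a vector w of the line, of the member of the pencil for
    which x is orthogonal to the line; so if it were a combination of the
    gradients at x, the difference of w and a multiple of x would be singular
    on X. *)
Lemma dense_contact_rank1 x : in_base A1 A2 x -> contact_mx_neq0 x -> ev f0 g x = 0.
Proof.
move=> hx mx; have [h1 h2] := hx.
have [d0|d0] := eqVneq (contact A1 A2 u1 u2 x) 0; last first.
  have := van (L := K) (f := idfun) (x := x); rewrite !map_idfun => /(_ hx d0) <-; exact: ev_eq.
have [y [y1 y2 y3]] : exists y, [/\ pol A1 x y = 0, pol A2 x y = 0 & contact_polar A1 A2 u1 u2 x y != 0].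
  (* With these vectors the derivative of the determinant at x along y is
     b1(g1, y) + b2(g2, y). *)
  pose g1 := pol A2 u2 x *: u1 - pol A2 u1 x *: u2.
  pose g2 := pol A1 u1 x *: u2 - pol A1 u2 x *: u1.
  have [[s [t est]]|[y [y1 y2 y3]]] := span2_or_separated (grad A1 x) (grad A2 x) (grad A1 g1 + grad A2 g2); last first.
    exists y; split=> //; rewrite (_ : contact_polar _ _ _ _ _ _ = pol A1 g1 y + pol A2 g2 y).
      by move: y3; rewrite mulmxDl mxE.
    by rewrite /contact_polar /g1 /g2 !polZE; ring.
  exfalso.
  have E y : pol A1 g1 y + pol A2 g2 y = s * pol A1 x y + t * pol A2 x y.
    have := congr1 (fun h => (h *m y^T) 0 0) est.
    by rewrite dot_comb -[_ + grad _ _]scale1r scalerDr dot_comb !mul1r.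
  have [r1 [r2 [s1 [s2 [e11 e12 e21 e22]]]]] := rank1_factor d0.
  have [l1 l2 l3 l4] := pol_line line (or_introl erefl).
  have [l5 l6 l7 l8] := pol_line line (or_intror erefl).
  have r0 : (r1 != 0) || (r2 != 0).
    apply: contraTT mx; rewrite negb_or !negbK => /andP[/eqP a /eqP b].
    by rewrite /contact_mx_neq0 e11 e12 e21 e22 a b !mul0r eqxx.
  have s0 : (s1 != 0) || (s2 != 0).
    apply: contraTT mx; rewrite negb_or !negbK => /andP[/eqP a /eqP b].
    by rewrite /contact_mx_neq0 e11 e12 e21 e22 a b !mulr0 eqxx.
  have sr : s * r1 + t * r2 = 0.
    have := E u1; have := E u2; rewrite /g1 /g2 !polZE l1 l2 l3 l4 l5 l6 l7 l8 ![pol _ x _]polC e11 e12 e21 e22.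
    rewrite !mulr0 !subrr !addr0 => f2 f1.
    have [h|h] := orP s0; apply: (mulIf h); rewrite mul0r mulrDl -!mulrA.
      by rewrite -f1.
    by rewrite -f2.
  have [l [sl tl]] : exists l, s = l * r2 /\ t = - (l * r1).
    have [r10|r10] := eqVneq r1 0.
      have r20 : r2 != 0 by move: r0; rewrite r10 eqxx.
      exists (s / r2); rewrite divfK //; split=> //; rewrite r10 mulr0 oppr0.
      by apply: (mulIf r20); rewrite mul0r -[RHS]sr r10 mulr0 add0r.
    have sr1 : s * r1 = - (t * r2) by apply/eqP; rewrite -addr_eq0 sr.
    exists (- t / r1); split; last by field.
    by apply: (mulIf r10); rewrite sr1; field.
  pose w := s2 *: u1 - s1 *: u2; pose z := w - l *: x.
  have z0 : z != 0.
    apply/eqP=> /eqP; rewrite subr_eq0 => /eqP wE.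
    have l0 : l = 0.
      apply/eqP; apply: contraT => l0; case/negP: (negbT (negbTE l0)).
      have H i : pol (if i then A2 else A1) u1 x = 0 /\ pol (if i then A2 else A1) u2 x = 0.
        have i1 : pol (if i then A2 else A1) u1 w = 0 by case: (i); rewrite /w !polZE ?l1 ?l2 ?l5 ?l6; ring.
        have i2 : pol (if i then A2 else A1) u2 w = 0 by case: (i); rewrite /w !polZE ?l3 ?l4 ?l7 ?l8; ring.
        by move: i1 i2; rewrite wE !polZr => /eqP + /eqP; rewrite !mulf_eq0 (negPf l0) /= => /eqP -> /eqP ->.
      have [a1 a2] := H false; have [a3 a4] := H true; move: mx.
      by rewrite /contact_mx_neq0 a1 a2 a3 a4 eqxx.
    move: wE; rewrite l0 scale0r /w -scaleNr => /(indep2P _ _ indep)[/eqP a1 /eqP a2].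
    by move: s0; rewrite oppr_eq0 in a2; rewrite a1 a2.
  have qz (A : 'M[K]_n) : qf A u1 = 0 -> qf A u2 = 0 -> pol A u1 u2 = 0 -> qf A x = 0 ->
      s2 * pol A u1 x = s1 * pol A u2 x -> qf A z = 0.
    move=> a1 a2 a3 a4 a5; rewrite /z /w !(qfE, polZE) a1 a2 a3 a4.
    transitivity (l * (s1 * pol A u2 x - s2 * pol A u1 x)); first by ring.
    by rewrite a5 subrr mulr0.
  have [[b1 b2] [b3 b4] _ _] := line.
  have [] := smoothP (s := r2) (t := - r1) sm z0 (qz _ b1 b3 l2 h1 _) (qz _ b2 b4 l6 h2 _).
  - by rewrite e11 e12; ring.
  - by rewrite e21 e22; ring.
  - move=> y; have := E y; rewrite /g1 /g2 e11 e12 e21 e22 sl tl /z /w !polZE => Ey.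
    by move: Ey => /eqP; rewrite -subr_eq0 => /eqP Ey; rewrite -[RHS]Ey; ring.
  by move=> r20 /eqP; rewrite oppr_eq0 => /eqP r10; move: r0; rewrite r10 r20 eqxx.
pose v := pC x + 'X *: pC y.
have lP : is_line (pC A1) (pC A2) (pC u1) (pC u2) by exact: is_line_map.
have dvE : contact (pC A1) (pC A2) (pC u1) (pC u2) v = 'X * ((contact_polar A1 A2 u1 u2 x y)%:P + 'X * (contact A1 A2 u1 u2 y)%:P).
  rewrite /v contactD !contact_map d0 raddf0 /contact_polar !pol_map !(rmorphB, rmorphD) !rmorphM /=; ring.
have qE (A : 'M[K]_n) : qf A x = 0 -> pol A x y = 0 -> qf (pC A) v = 'X ^+ 2 * (qf A y)%:P.
  by move=> e1 e2; rewrite /v !(qfE, polZE) !qf_map pol_map e1 e2 rmorph0; ring.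
pose r := ((contact_polar A1 A2 u1 u2 x y)%:P + 'X * (contact A1 A2 u1 u2 y)%:P) *: v
  - 'X *: ((pol (pC A2) (pC u2) v * (qf A1 y)%:P - pol (pC A1) (pC u2) v * (qf A2 y)%:P) *: pC u1
    + (pol (pC A1) (pC u1) v * (qf A2 y)%:P - pol (pC A2) (pC u1) v * (qf A1 y)%:P) *: pC u2).
apply: (@curve_limit 'X v r (contact_polar A1 A2 u1 u2 x y) x) => //.
- by rewrite polyX_eq0.
- rewrite /unproject dvE /cramer1 /cramer2 !qE // /r.
  move: (contact_polar _ _ _ _ _ _) (contact _ _ _ _ _) (pol _ _ v) (pol _ _ v) (pol _ _ v) (pol _ _ v) => c1 c2 c3 c4 c5 c6.
  by apply/rowP => j; rewrite !mxE; ring.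
- by rewrite dvE mulf_neq0 ?polyX_eq0 //; apply: poly_at0_neq0; rewrite !hornerE.
rewrite /r /v map_mxB map_mxZ map_mxD !map_mxZ at0_polyC /= !/(horner_eval _ _) !hornerE.
by rewrite !scale0r ?addr0 ?subr0.
Qed.

(** Suppose the matrix is singular at every tangent vector.  A linear space of
    singular 2 x 2 matrices has a common kernel or a common left kernel.  A
    common kernel u' gives u' the tangent space of x, against
    [tangent_distinct].  A common left kernel (r2, - r1) puts the gradients of
    r2 q1 - r1 q2 at u1 and u2 in the plane of the gradients at x, so that a
    combination of u1, u2 and x is a vertex of that quadric and lies on X. *)
Lemma tangent_contact_neq0 x : in_base A1 A2 x -> ~~ contact_mx_neq0 x -> row_free (col_mx u1 (col_mx u2 x)) ->
  exists y, [/\ pol A1 x y = 0, pol A2 x y = 0 & contact A1 A2 u1 u2 y != 0].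
Proof.
move=> [h1 h2]; rewrite /contact_mx_neq0 !negb_or !negbK => /and4P[/eqP m11 /eqP m12 /eqP m21 /eqP m22] /indep3P fr.
have [[b1 b2] [b3 b4] b5 b6] := line.
apply: NNPP => nex.
have dT y : pol A1 x y = 0 -> pol A2 x y = 0 -> contact A1 A2 u1 u2 y = 0.
  by move=> y1 y2; apply/eqP; apply: contraT => dy; case: nex; exists y.
have dT1 y z : pol A1 x y = 0 -> pol A2 x y = 0 -> pol A1 x z = 0 -> pol A2 x z = 0 ->
    contact_polar A1 A2 u1 u2 y z = 0.
  move=> y1 y2 z1 z2; have := contactD A1 A2 u1 u2 y z 1; rewrite !scale1r expr1n !mul1r.
  by rewrite !dT // ?polDr ?y1 ?y2 ?z1 ?z2 ?addr0 // add0r => <-.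
have [y [y1 y2 ny]] : exists y, [/\ pol A1 x y = 0, pol A2 x y = 0 & (pol A1 u1 y != 0) || (pol A2 u1 y != 0)].
  apply: tangent_distinct => //; try by rewrite polC.
  by apply/indep2P => a b ee; have [|-> _ ->] := fr b 0 a; rewrite // scale0r addr0 addrC.
pose r1 := pol A1 u1 y; pose r2 := pol A2 u1 y.
have [l [l1 l2]] : exists l, pol A1 u2 y = l * r1 /\ pol A2 u2 y = l * r2.
  have := dT y y1 y2; rewrite /contact -/r1 -/r2 => /eqP; rewrite subr_eq0 => /eqP d.
  have [r0|r0] := eqVneq r1 0.
    have r20 : r2 != 0 by move: ny; rewrite -/r1 -/r2 r0 eqxx.
    exists (pol A2 u2 y / r2); rewrite divfK //; split=> //; rewrite r0 mulr0.
    by apply: (mulIf r20); rewrite -d r0 !mul0r.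
  exists (pol A1 u2 y / r1); rewrite divfK //; split=> //.
  by apply: (mulfI r0); rewrite d; field.
(* The vector of the line in the kernel of the matrix at y. *)
pose u' := u2 - l *: u1.
have pu' A z : pol A u' z = pol A u2 z - l * pol A u1 z by rewrite /u' !polZE.
have [f1 [f11 f12 nf1]] : exists y, [/\ pol A1 x y = 0, pol A2 x y = 0 & (pol A1 u' y != 0) || (pol A2 u' y != 0)].
  apply: tangent_distinct => //; rewrite 1?polC ?pu' ?m11 ?m12 ?m21 ?m22 ?mulr0 ?subr0 //.
  - by rewrite /u' !(qfE, polZE) b1 b3 [pol A1 u2 u1]polC b5; ring.
  - by rewrite /u' !(qfE, polZE) b2 b4 [pol A2 u2 u1]polC b6; ring.
  apply/indep2P => a b ee; have [|e1 e2 ->] := fr (- (b * l)) b a; last by split.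
  by rewrite -[RHS]ee /u' scalerBr scalerA scaleNr addrC; congr (_ + _); rewrite addrC.
(* The determinant vanishes on the plane through y and f; this is the
   coefficient of its mixed term. *)
have prop f : pol A1 x f = 0 -> pol A2 x f = 0 -> r1 * pol A2 u' f - r2 * pol A1 u' f = 0.
  move=> i1 i2; have := dT1 y f y1 y2 i1 i2; rewrite /contact_polar l1 l2 -/r1 -/r2 !pu' => <-; ring.
have prod f : pol A1 x f = 0 -> pol A2 x f = 0 -> (pol A1 u' f != 0) || (pol A2 u' f != 0) ->
    r2 * pol A1 u1 f - r1 * pol A2 u1 f = 0.
  move=> i1 i2 nz; have p := prop f i1 i2.
  have : pol A1 u1 f * pol A2 u' f - pol A1 u' f * pol A2 u1 f = 0.
    by rewrite -(dT f i1 i2) /contact !pu'; ring.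
  have [la [q1 q2]] : exists la, pol A1 u' f = la * r1 /\ pol A2 u' f = la * r2.
    have [r0|r0] := eqVneq r1 0.
      have r20 : r2 != 0 by move: ny; rewrite -/r1 -/r2 r0 eqxx.
      exists (pol A2 u' f / r2); rewrite divfK //; split=> //; rewrite r0 mulr0.
      by apply: (mulfI r20); move: p; rewrite r0 mul0r mulr0 sub0r => /eqP; rewrite oppr_eq0 => /eqP.
    exists (pol A1 u' f / r1); rewrite divfK //; split=> //.
    move: p => /eqP; rewrite subr_eq0 => /eqP p.
    by apply: (mulfI r0); rewrite p; field.
  have la0 : la != 0 by apply: contraTneq nz => la0; rewrite q1 q2 la0 !mul0r eqxx.
  rewrite q1 q2 => /eqP pr; apply/eqP; rewrite -(mulrI_eq0 _ (mulfI la0)) -[X in _ == X](eqP pr).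
  by apply/eqP; ring.
(* Two linear conditions of which one holds at each tangent vector: as f1
   violates the other one, adding f1 shows that this one always holds. *)
have prodT f : pol A1 x f = 0 -> pol A2 x f = 0 -> r2 * pol A1 u1 f - r1 * pol A2 u1 f = 0.
  move=> i1 i2; case: (boolP ((pol A1 u' f != 0) || (pol A2 u' f != 0))) => [nz|].
    exact: prod.
  rewrite negb_or !negbK => /andP[/eqP n1 /eqP n2].
  have := prod (f1 + f); rewrite !polDr n1 n2 i1 i2 f11 f12 !addr0 => /(_ erefl erefl nf1).
  by move=> ee; rewrite -[RHS]ee -[LHS]addr0 -{1}(prod f1 f11 f12 nf1); ring.
have spanT v : (forall f, pol A1 x f = 0 -> pol A2 x f = 0 -> r2 * pol A1 v f - r1 * pol A2 v f = 0) ->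
    exists a b, forall f, r2 * pol A1 v f - r1 * pol A2 v f = a * pol A1 x f + b * pol A2 x f.
  move=> hv; have [[a [b ee]]|[f [i1 i2]]] := span2_or_separated (grad A1 x) (grad A2 x) (r2 *: grad A1 v + (- r1) *: grad A2 v).
    exists a, b => f; have := congr1 (fun h => (h *m f^T) 0 0) ee.
    by rewrite /= !dot_comb -!gradE mulNr.
  by rewrite dot_comb -!gradE mulNr hv ?eqxx.
have [a [b ab]] := spanT _ prodT.
have [|c [d cd]] := spanT u'.
  by move=> f i1 i2; have /eqP := prop f i1 i2; rewrite subr_eq0 => /eqP ->; rewrite subrr.
have [al [be [ka [nz d1 d2]]]] := linear_dep3 a b c d (- r2) r1.
pose z := al *: u1 + be *: u' + (- ka) *: x.
have z0 : z != 0.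
  apply/eqP => ee; have [|e1 e2 e3] := fr (al - be * l) be (- ka).
    by rewrite -[RHS]ee /z /u'; apply/rowP => j; rewrite !mxE; ring.
  move: nz e1; rewrite e2 mul0r subr0 => nz e1; move: nz.
  by rewrite e1 -[ka]opprK e3 oppr0 !eqxx.
have qz A : qf A u1 = 0 -> qf A u2 = 0 -> pol A u1 u2 = 0 -> qf A x = 0 -> pol A u1 x = 0 -> pol A u2 x = 0 -> qf A z = 0.
  by move=> i1 i2 i3 i4 i5 i6; rewrite /z /u' !(qfE, polZE) ?polxx [pol A u2 u1]polC i1 i2 i3 i4 i5 i6; ring.
have [] := smoothP (s := r2) (t := - r1) sm z0 (qz _ b1 b3 b5 h1 m11 m12) (qz _ b2 b4 b6 h2 m21 m22).
  move=> f; transitivity (al * (r2 * pol A1 u1 f - r1 * pol A2 u1 f) + be * (r2 * pol A1 u' f - r1 * pol A2 u' f) - ka * (r2 * pol A1 x f - r1 * pol A2 x f)).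
    by rewrite /z !polZE; ring.
  rewrite ab cd; transitivity ((al * a + be * c + ka * - r2) * pol A1 x f + (al * b + be * d + ka * r1) * pol A2 x f); first by ring.
  by rewrite d1 d2 !mul0r addr0.
by move=> r20 /eqP; rewrite oppr_eq0 => /eqP r10; move: ny; rewrite -/r1 -/r2 r10 r20 eqxx.
Qed.

(** When the matrix vanishes at x, the determinant along x + t y has order two
    in t, and the second summand of [unproject] has order three. *)
Lemma dense_contact_rank0 x : in_base A1 A2 x -> ~~ contact_mx_neq0 x -> row_free (col_mx u1 (col_mx u2 x)) -> ev f0 g x = 0.
Proof.
move=> hx mx fr; have [h1 h2] := hx.
have [y [y1 y2 y3]] := tangent_contact_neq0 hx mx fr.
move: mx; rewrite /contact_mx_neq0 !negb_or !negbK => /and4P[/eqP m11 /eqP m12 /eqP m21 /eqP m22].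
pose v := pC x + 'X *: pC y.
have pE A u : pol A u x = 0 -> pol (pC A) (pC u) v = 'X * (pol A u y)%:P.
  by move=> e0; rewrite /v !polZE !pol_map e0 rmorph0 add0r.
have dvE : contact (pC A1) (pC A2) (pC u1) (pC u2) v = 'X ^+ 2 * (contact A1 A2 u1 u2 y)%:P.
  by rewrite /contact !pE // rmorphB !rmorphM /=; ring.
have qE (A : 'M[K]_n) : qf A x = 0 -> pol A x y = 0 -> qf (pC A) v = 'X ^+ 2 * (qf A y)%:P.
  by move=> e1 e2; rewrite /v !(qfE, polZE) !qf_map pol_map e1 e2 rmorph0; ring.
pose r := (contact A1 A2 u1 u2 y)%:P *: v
  - 'X *: ((cramer1 A1 A2 u2 y y)%:P *: pC u1 + (cramer2 A1 A2 u1 y y)%:P *: pC u2).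
apply: (@curve_limit ('X ^+ 2) v r (contact A1 A2 u1 u2 y) x) => //.
- by rewrite expf_neq0 ?polyX_eq0.
- rewrite /unproject dvE /r /cramer1 /cramer2 !qE // !pE // !rmorphB !rmorphM /=.
  by apply/rowP => j; rewrite !mxE; ring.
- by rewrite dvE mulf_neq0 ?expf_neq0 ?polyX_eq0 ?polyC_eq0.
rewrite /r /v map_mxB map_mxZ map_mxD !map_mxZ at0_polyC /= !/(horner_eval _ _) !hornerE.
by rewrite !scale0r ?addr0 ?subr0.
Qed.

End OverK.

Notation pC A := (map_mx polyC A).
Notation toF := (@FracField.tofrac {poly _}).

(** A point u1 of the line itself.  Take y tangent at u1 with a nonzero matrix.
    Then [unproject y] is a multiple of u1, and in general not zero, so a curve
    y + t f works.  If it is zero, the residual system at y is solvable, which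
    gives a point v of X in the tangent space at u1: the line u1 + t v lies on
    X and its generic point is covered by the case of rank one. *)
Lemma dense_on_line (K : fieldType) (f0 : {rmorphism k -> K}) (A1 A2 : 'M[K]_n) u1 u2 :
  is_line A1 A2 u1 u2 -> vanishes_off_contact f0 A1 A2 u1 u2 -> smooth_pencil A1 A2 ->
  row_free (col_mx u1 u2) -> ev f0 g u1 = 0.
Proof.
move=> line van sm indep.
have [[b1 b2] [b3 b4] b5 b6] := line.
have [y [y1 y2 ny]] := tangent_distinct sm b1 b2 b3 b4 b5 b6 indep.
pose c1 := pol A1 u2 y; pose c2 := pol A2 u2 y.
have [d0|d0] := eqVneq (c2 * qf A1 y - c1 * qf A2 y) 0; last first.
  have [f nf] : exists f, c2 * pol A1 u1 f - c1 * pol A2 u1 f != 0.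
    apply: NNPP => nex.
    have u10 : u1 != 0.
      apply/eqP => u0; have [|/eqP] := indep2P _ _ indep 1 0; last by rewrite oner_eq0.
      by rewrite u0 scaler0 scale0r addr0.
    have [] := smoothP (s := c2) (t := - c1) sm u10 b1 b2.
      move=> f; apply/eqP; apply: contraT => nf; case: nex; exists f.
      by rewrite -mulNr.
    by move=> c20 /eqP; rewrite oppr_eq0 => /eqP c10; move: ny; rewrite -/c1 -/c2 c10 c20 eqxx.
  pose v := pC y + 'X *: pC f.
  apply: (curve_limit line van (c := 1) (v := v) (r := unproject (pC A1) (pC A2) (pC u1) (pC u2) v) (a := - (c2 * qf A1 y - c1 * qf A2 y))) => //.
  - exact: oner_neq0.
  - by rewrite scale1r.
  - rewrite /v contactD !contact_map /contact_polar !pol_map y1 y2 /contact y1 y2 -/c1 -/c2 !mul0r mulr0 subrr raddf0 !add0r.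
    rewrite (_ : _ + _ = 'X * ((c2 * pol A1 u1 f - c1 * pol A2 u1 f)%:P + 'X * (contact A1 A2 u1 u2 f)%:P)).
      by rewrite mulf_neq0 ?polyX_eq0 //; apply: poly_at0_neq0; rewrite !hornerE.
    by rewrite /contact !(rmorphB, rmorphM) /=; ring.
  - rewrite -unproject_map !at0_polyC /v map_mxD map_mxZ !at0_polyC /= /horner_eval hornerX scale0r addr0.
    rewrite /unproject /contact /cramer1 /cramer2 y1 y2 -/c1 -/c2 !mul0r mulr0 !subrr !scale0r addr0 sub0r.
    by rewrite scaleNr.
  - by rewrite oppr_eq0.
have [l [l1 l2]] : exists l, qf A1 y = l * c1 /\ qf A2 y = l * c2.
  have [r0|r0] := eqVneq c1 0.
    have r20 : c2 != 0 by move: ny; rewrite -/c1 -/c2 r0 eqxx.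
    exists (qf A2 y / c2); rewrite divfK //; split=> //; rewrite r0 mulr0.
    by apply: (mulfI r20); move: d0; rewrite r0 mul0r mulr0 subr0.
  exists (qf A1 y / c1); rewrite divfK //; split=> //.
  move: d0 => /eqP; rewrite subr_eq0 => /eqP d0.
  by apply: (mulfI r0); rewrite -d0; field.
pose v := y - l *: u2; pose z := pC u1 + 'X *: pC v.
have qv (A : 'M[K]_n) c : qf A y = l * c -> c = pol A u2 y -> qf A u2 = 0 -> qf A v = 0.
  by move=> i1 i2 i3; rewrite /v !(qfE, polZE) i1 i3 [pol A y u2]polC -i2; ring.
have qz (A : 'M[K]_n) : qf A u1 = 0 -> qf A v = 0 -> pol A u1 v = 0 -> qf (pC A) z = 0.
  by move=> i1 i2 i3; rewrite /z !(qfE, polZE) !qf_map pol_map i1 i2 i3 !rmorph0; ring.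
have p1 : pol A1 u1 v = 0 by rewrite /v !polZE y1 b5; ring.
have p2 : pol A2 u1 v = 0 by rewrite /v !polZE y2 b6; ring.
have mE p q (A : 'M[K]_(p, q)) : map_mx (@polyF K) A = map_mx toF (pC A) by rewrite -map_mx_comp.
have h : ev (@polyF K \o f0) g (map_mx toF (1 *: z)) = 0.
  rewrite scale1r; apply: (dense_contact_rank1 (is_line_map (@polyF K) line) (vanishes_off_contact_ext van)
    (smooth_pencil_ext sm) _).
  - by have := row_free_map (@polyF K) (col_mx u1 u2); rewrite map_col_mx => ->.
  - rewrite !mE; apply: in_base_map; split; apply: qz => //.
      exact: (qv _ c1).
    exact: (qv _ c2).
  have pE (A : 'M[K]_n) : qf A u2 = 0 -> pol A u1 u2 = 0 ->
      pol (map_mx (@polyF K) A) (map_mx (@polyF K) u2) (map_mx toF z) = toF ('X * (pol A u2 y)%:P).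
    move=> i1 i2; rewrite !mE pol_map /z !polZE !pol_map [pol A u2 u1]polC i2 raddf0 add0r.
    by rewrite /v !polZE polxx i1 mul0rn mulr0 subr0.
  have nzE c : c != 0 -> toF ('X * c%:P) != 0 :> {fraction {poly K}}.
    by move=> c0; rewrite tofrac_eq0 mulf_neq0 ?polyX_eq0 ?polyC_eq0.
  apply/or4P; case/orP: ny => /nzE nz.
    by apply: Or42; rewrite pE.
  by apply: Or44; rewrite pE.
have := specialize hg (oner_neq0 _) h.
by rewrite /z map_mxD map_mxZ !at0_polyC /= /horner_eval hornerX scale0r addr0.
Qed.

(** A unimodular change of basis of the line preserves the determinant. *)
Lemma vanishes_off_contact_basis (K : fieldType) (f0 : {rmorphism k -> K}) (A1 A2 : 'M[K]_n) u1 u2 a b c d :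
  a * d - b * c = 1 -> vanishes_off_contact f0 A1 A2 u1 u2 ->
  vanishes_off_contact f0 A1 A2 (a *: u1 + b *: u2) (c *: u1 + d *: u2).
Proof.
move=> det van L f x hx nz; apply: van => //; apply: contraNneq nz => dx.
rewrite -(mulr0 (f (a * d - b * c))) -dx /contact !map_mxD !map_mxZ !polZE rmorphB !rmorphM; apply/eqP; ring.
Qed.

Theorem dense_off_contact (K : fieldType) (f0 : {rmorphism k -> K}) (A1 A2 : 'M[K]_n) u1 u2 :
  is_line A1 A2 u1 u2 -> vanishes_off_contact f0 A1 A2 u1 u2 -> smooth_pencil A1 A2 ->
  row_free (col_mx u1 u2) ->
  forall x, in_base A1 A2 x -> x != 0 -> ev f0 g x = 0.
Proof.
move=> line van sm indep x hx x0.
case: (boolP (contact_mx_neq0 A1 A2 u1 u2 x)) => [|mx]; first exact: dense_contact_rank1.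
case: (boolP (row_free (col_mx u1 (col_mx u2 x)))) => [fr|nfr]; first exact: (dense_contact_rank0 line).
have [a [b xE]] : exists a b, x = a *: u1 + b *: u2.
  apply: NNPP => nex; case/negP: nfr; apply/indep3P => a b c e0.
  have [c0|c0] := eqVneq c 0.
    by move: e0; rewrite c0 scale0r addr0 => /(indep2P _ _ indep)[-> ->].
  case: nex; exists (- (a / c)), (- (b / c)).
  move: e0 => /eqP; rewrite addr_eq0 => /eqP e0; apply: (scalerI c0); rewrite scalerDr !scalerA.
  rewrite -[LHS]opprK -e0 opprD -!scaleNr; congr (_ *: _ + _ *: _); field => //.
have [c [d det]] : exists c d, a * d - b * c = 1.
  have [a0|a0] := eqVneq a 0; last by exists 0, (a^-1); rewrite divff // mulr0 subr0.
  have b0 : b != 0 by apply: contraNneq x0 => b0; rewrite xE a0 b0 !scale0r addr0.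
  by exists (- b^-1), 0; rewrite mulr0 sub0r mulrN opprK divff.
have [[b1 b2] [b3 b4] b5 b6] := line.
have qb (A : 'M[K]_n) s t : qf A u1 = 0 -> qf A u2 = 0 -> pol A u1 u2 = 0 -> qf A (s *: u1 + t *: u2) = 0.
  by move=> i1 i2 i3; rewrite !(qfE, polZE) i1 i2 i3; ring.
have pb (A : 'M[K]_n) s t s' t' : qf A u1 = 0 -> qf A u2 = 0 -> pol A u1 u2 = 0 -> pol A (s *: u1 + t *: u2) (s' *: u1 + t' *: u2) = 0.
  by move=> i1 i2 i3; rewrite !polZE !polxx [pol A u2 u1]polC i1 i2 i3; ring.
rewrite xE; apply: (dense_on_line _ (vanishes_off_contact_basis det van)) => //.
  by split; [split; apply: qb|split; apply: qb|apply: pb|apply: pb].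
apply/indep2P => s t e0.
have [|e1 e2] := indep2P _ _ indep (s * a + t * c) (s * b + t * d).
  by rewrite -[RHS]e0; apply/rowP => j; rewrite !mxE; ring.
have sE : s * 1 = d * (s * a + t * c) - c * (s * b + t * d) by rewrite -det; ring.
have tE : t * 1 = a * (s * b + t * d) - b * (s * a + t * c) by rewrite -det; ring.
by move: sE tE; rewrite e1 e2 !mulr1 !mulr0 subrr.
Qed.
End Density.

(** * Points, forms and projective space *)

Definition rowv (K : fieldType) n (x : 'I_n -> K) : 'rV[K]_n := \row_i x i.

Section Bridge.
Variables (k K : fieldType) (f : {rmorphism k -> K}).

Lemma eval_atE n (g : {mpoly k[n]}) x : eval_at f g x = ev f g (rowv x).
Proof. by apply: meval_eq => i; rewrite mxE. Qed.

Lemma nonzero_vecE n (x : 'I_n -> K) : nonzero_vec x <-> rowv x != 0.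
Proof.
split=> [[i xi]|h]; first by apply: contraNneq xi => /rowP/(_ i); rewrite !mxE => ->.
apply: NNPP => nex; case/negP: h; apply/eqP/rowP => i; rewrite !mxE.
by apply/eqP; apply: contraT => xi; case: nex; exists i.
Qed.

Lemma rowvK n (r : 'rV[K]_n) : rowv (fun i => r 0 i) = r.
Proof. by apply/rowP => i; rewrite mxE. Qed.

Lemma eval_mapE r s (V : 'rV[{mpoly k[r]}]_s) x :
  rowv (eval_map f (fun i => V 0 i) x) = map_mx (evx f (rowv x)) V.
Proof. by apply/rowP => i; rewrite !mxE /eval_map eval_atE. Qed.
End Bridge.

Section HomogeneousVectors.
Variables (k : fieldType) (r : nat).
Notation R := {mpoly k[r]}.

Definition homogv s e (V : 'rV[R]_s) := forall i, V 0 i \is e.-homog.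

Lemma homogvD s e (V W : 'rV[R]_s) : homogv e V -> homogv e W -> homogv e (V + W).
Proof. by move=> hV hW i; rewrite mxE; apply: rpredD. Qed.
Lemma homogvN s e (V : 'rV[R]_s) : homogv e V -> homogv e (- V).
Proof. by move=> hV i; rewrite mxE rpredN. Qed.
Lemma homogvB s e (V W : 'rV[R]_s) : homogv e V -> homogv e W -> homogv e (V - W).
Proof. by move=> hV hW; apply: homogvD => //; apply: homogvN. Qed.
Lemma homogvZ s m p c (V : 'rV[R]_s) : c \is m.-homog -> homogv p V -> homogv (m + p) (c *: V).
Proof. by move=> hc hV i; rewrite mxE; apply: dhomogM. Qed.
Lemma homogvC s (V : 'rV[k]_s) : homogv 0 (constmx r V).
Proof. by move=> i; rewrite mxE -[_%:MP]mulr1 mul_mpolyC; apply: dhomogZ; apply: dhomog1. Qed.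
Lemma homogv_mulC s t e (V : 'rV[R]_s) (A : 'M[k]_(s, t)) : homogv e V -> homogv e (V *m constmx r A).
Proof.
move=> hV i; rewrite mxE; apply: rpred_sum => j _.
by rewrite mxE mulrC mul_mpolyC; apply: dhomogZ.
Qed.
Lemma homogv_bil s m p (A : 'M[k]_s) (V W : 'rV[R]_s) : homogv m V -> homogv p W ->
  bil (constmx r A) V W \is (m + p).-homog.
Proof.
move=> hV hW; rewrite /bil mxE; apply: rpred_sum => j _.
by rewrite [W^T _ _]mxE; apply: dhomogM => //; apply: homogv_mulC.
Qed.
Lemma homogv_qf s m (A : 'M[k]_s) (V : 'rV[R]_s) : homogv m V -> qf (constmx r A) V \is (m + m).-homog.
Proof. by move=> hV; apply: homogv_bil. Qed.
Lemma homogv_pol s m p (A : 'M[k]_s) (V W : 'rV[R]_s) : homogv m V -> homogv p W ->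
  pol (constmx r A) V W \is (m + p).-homog.
Proof. by move=> hV hW; rewrite polE rpredD //; [|rewrite addnC]; apply: homogv_bil. Qed.
Lemma homogvX : homogv 1 (@vecX r k).
Proof. by move=> i; rewrite mxE dhomogX; apply/eqP; exact: mdeg1. Qed.
End HomogeneousVectors.

(** The generic point of P^r, over the field of fractions of k[x0, ..., xr].  A
    form that vanishes there is zero. *)
Section Generic.
Variables (k : fieldType) (r : nat).
Notation R := {mpoly k[r.+1]}.
Definition genK : k -> {fraction R} := @FracField.tofrac R \o @mpolyC r.+1 k.
HB.instance Definition _ := GRing.RMorphism.on genK.
Definition genpt : 'rV[{fraction R}]_r.+1 := map_mx (@FracField.tofrac R) vecX.

Lemma ev_genpt (g : R) : ev genK g genpt = FracField.tofrac g.
Proof. by rewrite -[g in RHS]ev_vecX ev_morph. Qed.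

Lemma map_genpt s t (A : 'M[k]_(s, t)) : map_mx genK A = map_mx (@FracField.tofrac R) (constmx r.+1 A).
Proof. by rewrite -map_mx_comp. Qed.

Lemma genpt_neq0 : genpt != 0.
Proof.
apply/eqP => /rowP/(_ 0); rewrite !mxE => /eqP; rewrite tofrac_eq0 => /eqP /(congr1 (mcoeff U_(0))).
by rewrite mcoeffX eqxx mcoeff0 => /eqP; rewrite oner_eq0.
Qed.

Lemma closed_sub_generic (Z : eqns k r) :
  (forall g, Z g -> ev genK g genpt = 0) -> closed_sub (@proj_space k r) Z.
Proof.
move=> h K f x [x0 _]; split=> // g /h; rewrite ev_genpt => /eqP; rewrite tofrac_eq0 => /eqP ->.
by rewrite /eval_at rmorph0 meval0.
Qed.

Lemma proj_space_dense s (V : 'rV[R]_s) (Z : eqns k r) : V != 0 ->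
  (forall (K : fieldType) (f : {rmorphism k -> K}) (x : 'I_r.+1 -> K),
     in_zeros f (@proj_space k r) x -> nonzero_vec (eval_map f (fun i => V 0 i) x) -> in_zeros f Z x) ->
  closed_sub (@proj_space k r) Z.
Proof.
move=> V0 h; apply: closed_sub_generic => g Zg.
have [||_ /(_ g Zg)] := h _ genK (fun i => genpt 0 i).
- by split=> //; apply/nonzero_vecE; rewrite rowvK genpt_neq0.
- apply/nonzero_vecE; rewrite eval_mapE rowvK; apply: contraNneq V0 => /rowP e; apply/eqP/rowP => i.
  by have /eqP := e i; rewrite !mxE evxE ev_genpt tofrac_eq0 => /eqP.
by rewrite eval_atE rowvK.
Qed.
End Generic.

(** * Rationality from a line *)

(** Coordinates on the space of planes through the line: P projects along the
    line onto a complement, and C is the inclusion of the complement. *)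
Lemma line_complement (k : fieldType) d (u1 u2 : 'rV[k]_d.+3) : row_free (col_mx u1 u2) ->
  exists (C : 'M[k]_(d.+1, d.+3)) (P : 'M[k]_(d.+3, d.+1)) (Q : 'M[k]_(d.+3, 1 + 1)),
  [/\ C *m P = 1%:M, u1 *m P = 0, u2 *m P = 0 & 1%:M = P *m C + Q *m col_mx u1 u2].
Proof.
set U := col_mx u1 u2 => fr.
pose E : 'M[k]_(2 + d.+1) := row_ebase U; pose B : 'M[k]_2 := col_ebase U.
have uE : E \in unitmx by exact: row_ebase_unit.
have uB : B \in unitmx by exact: col_ebase_unit.
have UE : (U : 'M_(2, 2 + d.+1)) = B *m usubmx E.
  rewrite -[LHS]mulmx_ebase -mulmxA; congr (_ *m _).
  have <- : (row_mx 1%:M 0 : 'M_(2, 2 + d.+1)) *m E = usubmx E.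
    by rewrite -{1}[E]vsubmxK mul_row_col mul1mx mul0mx addr0.
  by move: fr; rewrite /row_free => /eqP ->; rewrite -pid_mx_row.
pose L := lsubmx (invmx E : 'M_(2 + d.+1, 2 + d.+1)); pose P := rsubmx (invmx E : 'M_(2 + d.+1, 2 + d.+1)).
have e5 : L *m usubmx E + P *m dsubmx E = 1%:M by rewrite -mul_row_col vsubmxK hsubmxK mulVmx.
have /eq_block_mx[e1 e2 e3 e4] : block_mx (usubmx E *m L) (usubmx E *m P) (dsubmx E *m L) (dsubmx E *m P)
    = block_mx 1%:M 0 0 1%:M.
  by rewrite -mul_col_row vsubmxK hsubmxK mulmxV // scalar_mx_block.
have /eq_col_mx[h1 h2] : col_mx (u1 *m P) (u2 *m P) = col_mx 0 0.
  by rewrite -mul_col_mx -/U [U]UE -mulmxA e2 mulmx0 col_mx0.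
exists (dsubmx E), P, (L *m invmx B); split=> //.
by rewrite addrC -/U [U]UE mulmxA mulmxKV // e5.
Qed.

Lemma in_zerosE (k K : fieldType) (f : {rmorphism k -> K}) n (q : 2.-tuple {mpoly k[n.+1]}) A1 A2 :
  tnth q 0 = qf (constmx n.+1 A1) vecX -> tnth q 1 = qf (constmx n.+1 A2) vecX -> forall x,
  in_zeros f (eqns_of q) x <-> rowv x != 0 /\ in_base (map_mx f A1) (map_mx f A2) (rowv x).
Proof.
move=> e1 e2 x; split=> [[/nonzero_vecE x0 h]|[x0 [h1 h2]]].
  split=> //; split; rewrite -ev_qf -?e1 -?e2 -eval_atE; apply: h; exact: mem_tnth.
split; first exact/nonzero_vecE.
move=> g /tnthP[i ->]; rewrite eval_atE.
have [->|->] : i = 0 \/ i = 1 by case: i => [[|[|]]] //= p; [left|right]; apply: val_inj.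
  by rewrite e1 ev_qf.
by rewrite e2 ev_qf.
Qed.

Lemma same_pointE (K : fieldType) n (x y : 'I_n -> K) c : c != 0 -> rowv y = c *: rowv x -> same_point x y.
Proof. by move=> c0 /rowP e; exists c => // i; have := e i; rewrite !mxE. Qed.

Section Rational.
Variables (k : fieldType) (d : nat) (q : 2.-tuple {mpoly k[d.+3]}) (A1 A2 : 'M[k]_d.+3) (u1 u2 : 'rV[k]_d.+3).
Hypothesis q1 : tnth q 0 = qf (constmx d.+3 A1) vecX.
Hypothesis q2 : tnth q 1 = qf (constmx d.+3 A2) vecX.
Hypothesis sm : smooth_pencil A1 A2.
Hypothesis line : is_line A1 A2 u1 u2.
Hypothesis indep : row_free (col_mx u1 u2).

(** If the determinant were zero everywhere, its polarization would be too; at a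
    tangent vector y of u1 this is the polar form at u1 of a member of the
    pencil, so u1 would be singular on X. *)
Lemma exists_contact_neq0 : exists v, contact A1 A2 u1 u2 v != 0.
Proof.
have [[b1 b2] [b3 b4] b5 b6] := line.
have [y [y1 y2 ny]] := tangent_distinct sm b1 b2 b3 b4 b5 b6 indep.
apply: NNPP => nex.
have d0 v : contact A1 A2 u1 u2 v = 0.
  by apply/eqP; apply: contraT => nv; case: nex; exists v.
have u10 : u1 != 0.
  apply/eqP => u0; have [|/eqP] := indep2P _ _ indep 1 0; last by rewrite oner_eq0.
  by rewrite u0 scaler0 scale0r addr0.
have [] := smoothP (s := pol A2 u2 y) (t := - pol A1 u2 y) sm u10 b1 b2.
  move=> f; have := contactD A1 A2 u1 u2 y f 1; rewrite !d0 mulr0 addr0 add0r mul1r /contact_polar y1 y2.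
  by rewrite !mul0r mulr0 add0r subr0 => e0; rewrite [RHS]e0; ring.
by move=> c20 /eqP; rewrite oppr_eq0 => /eqP c10; move: ny; rewrite c10 c20 eqxx.
Qed.

Theorem rational_of_line : has_dim (eqns_of q) d -> rational (eqns_of q).
Proof.
move=> hd; exists d => //.
have [C [P [Q [CP u1P u2P PCQ]]]] := line_complement indep.
pose FV : 'rV[{mpoly k[d.+3]}]_d.+1 := vecX *m constmx _ P.
pose GV : 'rV[{mpoly k[d.+1]}]_d.+3 := unproject (constmx _ A1) (constmx _ A2) (constmx _ u1) (constmx _ u2) (vecX *m constmx _ C).
pose F i := FV 0 i; pose G i := GV 0 i.
have FE (K : fieldType) (f : {rmorphism k -> K}) x : rowv (eval_map f F x) = rowv x *m map_mx f P.
  by rewrite eval_mapE map_mxM map_evxC map_evxX.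
pose liftK (K : fieldType) (f : {rmorphism k -> K}) := unproject (map_mx f A1) (map_mx f A2) (map_mx f u1) (map_mx f u2).
pose dtK (K : fieldType) (f : {rmorphism k -> K}) := contact (map_mx f A1) (map_mx f A2) (map_mx f u1) (map_mx f u2).
have GE (K : fieldType) (f : {rmorphism k -> K}) y : rowv (eval_map f G y) = liftK K f (rowv y *m map_mx f C).
  by rewrite eval_mapE -unproject_map map_mxM !map_evxC map_evxX.
have lineK (K : fieldType) (f : {rmorphism k -> K}) := is_line_map f line.
have smK (K : fieldType) (f : {rmorphism k -> K}) := smooth_pencil_ext (f := f) sm.
have indepK (K : fieldType) (f : {rmorphism k -> K}) : row_free (col_mx (map_mx f u1) (map_mx f u2)).
  by rewrite -map_col_mx row_free_map.
have decomp (K : fieldType) (f : {rmorphism k -> K}) (x : 'rV[K]_d.+3) :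
    exists a b, x *m map_mx f P *m map_mx f C = x + (a *: map_mx f u1 + b *: map_mx f u2).
  have := congr1 (fun M => x *m map_mx f M) PCQ; rewrite map_mx1 mulmx1 map_mxD !map_mxM map_col_mx mulmxDr !mulmxA => xE.
  move: (x *m map_mx f Q) xE => w; rewrite -[w]hsubmxK mul_row_col [lsubmx w]mx11_scalar [rsubmx w]mx11_scalar !mul_scalar_mx.
  move: (lsubmx w 0 0) (rsubmx w 0 0) => a b xE; exists (- a), (- b).
  by rewrite {2}xE !scaleNr -opprD addrK.
have liftPC (K : fieldType) (f : {rmorphism k -> K}) x : liftK K f (x *m map_mx f P *m map_mx f C) = liftK K f x.
  by have [a [b ->]] := decomp K f x; rewrite /liftK unproject_line_translate.
have dtPC (K : fieldType) (f : {rmorphism k -> K}) x : dtK K f (x *m map_mx f P *m map_mx f C) = dtK K f x.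
  by have [a [b ->]] := decomp K f x; rewrite /dtK contact_line_translate.
have dt0 (K : fieldType) (f : {rmorphism k -> K}) : dtK K f 0 = 0.
  by rewrite /dtK -(scale0r 0) contactZ expr0n mul0r.
have liftP (K : fieldType) (f : {rmorphism k -> K}) y : liftK K f (y *m map_mx f C) *m map_mx f P = dtK K f (y *m map_mx f C) *: y.
  rewrite /liftK /unproject -/(dtK K f _) mulmxBl -scalemxAl -mulmxA -map_mxM CP map_mx1 mulmx1 mulmxDl -!scalemxAl.
  by rewrite -!map_mxM u1P u2P !map_mx0 !scaler0 addr0 subr0.
have lift_neq0 (K : fieldType) (f : {rmorphism k -> K}) v : dtK K f v != 0 -> liftK K f v != 0.
  move=> nz; have : dtK K f (liftK K f v) != 0 by rewrite /dtK contact_unproject // expf_eq0.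
  by apply: contraNneq => ->; rewrite dt0.
have onX (K : fieldType) (f : {rmorphism k -> K}) x := in_zerosE f q1 q2 x.
have denseX (Z : eqns k d.+2) : homogeneous Z ->
   (forall (K : fieldType) (f : {rmorphism k -> K}) (x : 'rV[K]_d.+3), x != 0 ->
     in_base (map_mx f A1) (map_mx f A2) x -> dtK K f x != 0 -> forall g, Z g -> ev f g x = 0) ->
   closed_sub (eqns_of q) Z.
  move=> hZ h K f x /onX[x0 hx]; split=> [|g Zg]; first exact/nonzero_vecE.
  have [e hg] := hZ g Zg; rewrite eval_atE.
  apply: (dense_off_contact hg (lineK K f) _ (smK K f) (indepK K f)) => // L f' y.
  rewrite -!map_mx_comp => hy dy.
  have y0 : y != 0 by apply: contraNneq dy => ->; rewrite [contact _ _ _ _ _](dt0 L (f' \o f)).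
  by rewrite (h L (f' \o f) y).
have [v dv] := exists_contact_neq0.
(* The determinant is a nonzero polynomial in the coordinates of P^d. *)
have dgen : dtK _ (@genK k d) (@genpt k d *m map_mx (@genK k d) C) != 0.
  rewrite /dtK !map_genpt -map_mxM contact_map tofrac_eq0.
  apply: contraNneq dv => /(congr1 (evx idfun (v *m P))).
  rewrite rmorph0 /= -contact_map map_mxM !map_evxC map_evxX !map_idfun.
  by have := dtPC k idfun v; rewrite /dtK !map_idfun => -> ->.
exists F, G; split.
- split; [split|].
  + exists 1%N => i; apply: homogv_mulC; exact: homogvX.
  + move=> Z hZ h; apply: denseX => // K f x x0 hx dx g Zg.
    have [||_ /(_ g Zg)] := h K f (fun i => x 0 i).
    * by apply/onX; rewrite rowvK.
    * apply/nonzero_vecE; rewrite FE rowvK; apply: contraNneq dx => xP.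
      by rewrite -dtPC xP mul0mx dt0.
    by rewrite eval_atE rowvK.
  + by move=> K f x hx nz; split.
  move=> Z hZ h; apply: closed_sub_generic => g Zg.
  have [e hg] := hZ g Zg.
  pose y := liftK _ (@genK k d) (@genpt k d *m map_mx (@genK k d) C).
  have [||_ /(_ g Zg)] := h _ (@genK k d) (fun i => y 0 i).
  + apply/onX; rewrite rowvK; split; first exact: lift_neq0.
    exact: in_base_unproject.
  + apply/nonzero_vecE; rewrite FE rowvK liftP scaler_eq0 negb_or dgen; exact: genpt_neq0.
  rewrite eval_atE FE rowvK liftP (ev_homog _ _ _ hg) => /eqP.
  by rewrite mulf_eq0 expf_eq0 (negPf dgen) andbF => /eqP.
- split; [split|].
  + exists 3%N => i; rewrite /G; move: i; rewrite -/(homogv 3 GV).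
    have hX : homogv 1 (vecX *m constmx d.+1 C) by apply: homogv_mulC; exact: homogvX.
    have hp A u : pol (constmx d.+1 A) (constmx d.+1 u) (vecX *m constmx d.+1 C) \is (1.-homog).
      by have := homogv_pol A (homogvC d.+1 u) hX.
    have hq A := homogv_qf A hX.
    apply: homogvB; first by apply: (homogvZ (m := 2)) hX; rewrite /contact rpredB //; apply: (dhomogM (d := 1)).
    by apply: homogvD; apply: (homogvZ (m := 3) _ (homogvC _ _)); rewrite rpredB //; apply: (dhomogM (d := 1) _ (hq _)).
  + move=> Z hZ h; apply: proj_space_dense h; apply/eqP => G0.
    have := lift_neq0 _ _ _ dgen; rewrite /liftK !map_genpt -map_mxM unproject_map.
    by rewrite -/GV G0 map_mx0 eqxx.
  + move=> K f y _ /nonzero_vecE nz; apply/onX; split=> //; rewrite GE; exact: in_base_unproject.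
  move=> Z hZ h; apply: denseX => // K f x x0 hx dx g Zg.
  have GxE : rowv (eval_map f G (fun i => (x *m map_mx f P) 0 i)) = dtK K f x *: x.
    by rewrite GE rowvK liftPC /liftK unproject_base.
  have [e hg] := hZ g Zg.
  have [||_ /(_ g Zg)] := h K f (fun i => (x *m map_mx f P) 0 i).
  + split=> //; apply/nonzero_vecE; rewrite rowvK; apply: contraNneq dx => xP.
    by rewrite -dtPC xP mul0mx dt0.
  + by apply/nonzero_vecE; rewrite GxE scaler_eq0 negb_or dx.
  rewrite eval_atE GxE (ev_homog _ _ _ hg) => /eqP.
  by rewrite mulf_eq0 expf_eq0 (negPf dx) andbF => /eqP.
- move=> K f x /onX[x0 hx] _ /nonzero_vecE; rewrite GE FE liftPC /liftK unproject_base // => nz.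
  apply: (same_pointE (c := dtK K f (rowv x))).
    by move: nz; rewrite scaler_eq0 negb_or => /andP[].
  by rewrite GE FE liftPC /liftK unproject_base.
move=> K f y _ _ /nonzero_vecE; rewrite FE GE liftP => nz.
apply: (same_pointE (c := dtK K f (rowv y *m map_mx f C))); last by rewrite FE GE liftP.
by move: nz; rewrite scaler_eq0 negb_or => /andP[].
Qed.
End Rational.

(** * Common isotropic subspaces and linear subspaces of X *)

Section Isotropic.
Variables (K : fieldType) (N : nat).
Implicit Types (B S T W : 'M[K]_N) (x y v : 'rV[K]_N).

Definition alternating B := forall x, bil B x x = 0.
Definition isotropic B W := forall x y, (x <= W)%MS -> (y <= W)%MS -> bil B x y = 0.

Lemma alternatingC B x y : alternating B -> bil B x y = - bil B y x.
Proof.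
move=> h; have := h (x + y); rewrite bilDl !bilDr !h add0r addr0 => /eqP.
by rewrite addr_eq0 => /eqP.
Qed.

Lemma shrink_mx S r : (r <= \rank S)%N -> exists T, (T <= S)%MS /\ \rank T = r.
Proof.
move=> le; exists (pid_mx r *m row_ebase S); split; last first.
  rewrite mxrankMfree ?row_free_unit ?row_ebase_unit // rank_pid_mx //;
  exact: (leq_trans le (rank_leq_row S)).
apply/submxP; exists (pid_mx r *m invmx (col_ebase S)).
rewrite -[X in _ = _ *m X](mulmx_ebase S) !mulmxA mulmxKV ?col_ebase_unit //.
rewrite mul_pid_mx; congr (pid_mx _ *m _); have := rank_leq_row S; lia.
Qed.

Lemma mul_row_bil B e f x :
  x *m row_mx (B *m e^T) (B *m f^T) = row_mx (bil B x e)%:M (bil B x f)%:M.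
Proof. by rewrite mul_mx_row !mulmxA [x *m B *m e^T]mx11_scalar [x *m B *m f^T]mx11_scalar. Qed.

Lemma in_ker2 B e f x : (x <= kermx (row_mx (B *m e^T) (B *m f^T)))%MS <-> bil B x e = 0 /\ bil B x f = 0.
Proof.
have E := mul_row_bil B e f x.
split=> [/sub_kermxP|[h1 h2]]; last by apply/sub_kermxP; rewrite E h1 h2 !raddf0 row_mx0.
rewrite E -[0 in RHS](@row_mx0 _ 1 1 1) => /eq_row_mx[/matrixP/(_ 0 0) h1 /matrixP/(_ 0 0) h2].
by move: h1 h2; rewrite !mxE !mulr1n.
Qed.

(** If b(e, f) is not zero, the orthogonal of e and f in S is a complement of
    their span, of dimension two less; a radical vector of it is radical in S. *)
Lemma odd_radical B S : alternating B -> odd (\rank S) ->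
  exists v, [/\ v != 0, (v <= S)%MS & forall y, (y <= S)%MS -> bil B v y = 0].
Proof.
move=> alt; elim: {S}(\rank S).+1 {-2}S (ltnSn (\rank S)) => // r IH S; rewrite ltnS => ler oddS.
case: (classic (isotropic B S)) => [iso|niso].
  have /rowV0Pn[v vS v0] : S != 0 by apply: contraTneq oddS => ->; rewrite mxrank0.
  by exists v; split=> // y yS; apply: iso.
have [e [f [eS fS ef]]] : exists e f, [/\ (e <= S)%MS, (f <= S)%MS & bil B e f != 0].
  apply: NNPP => nex; apply: niso => e f eS fS; apply/eqP; apply: contraT => ef.
  by case: nex; exists e, f.
pose M := row_mx (B *m e^T) (B *m f^T); pose S' := (S :&: kermx M)%MS.
have fe : bil B f e != 0 by rewrite alternatingC // oppr_eq0.
have rk2 : \rank (S *m M) = 2.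
  apply/eqP; rewrite eqn_leq rank_leq_col /=.
  have sub : (col_mx (e *m M) (f *m M) <= S *m M)%MS.
    by rewrite col_mx_sub !submxMr.
  apply: leq_trans (mxrankS sub).
  suff : row_free (col_mx (e *m M) (f *m M)) by rewrite /row_free => /eqP ->.
  apply/indep2P => a b; rewrite /M !mul_row_bil !alt !scale_row_mx add_row_mx -[0 in RHS](@row_mx0 _ 1 1 1).
  case/eq_row_mx => /matrixP/(_ 0 0) h1 /matrixP/(_ 0 0) h2; move: h1 h2.
  rewrite !mxE !mulr1n !mulr0 add0r addr0.
  by move=> /eqP + /eqP; rewrite !mulf_eq0 (negPf ef) (negPf fe) !orbF => /eqP -> /eqP ->.
have rkS : (2 + \rank S')%N = \rank S by have := mxrank_mul_ker S M; rewrite rk2.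
have [||v [v0 vS hv]] := IH S'.
- by move: ler rkS; lia.
- by move: oddS; rewrite -rkS /= negbK.
move: vS; rewrite sub_capmx => /andP[vS /in_ker2[ve vf]].
exists v; split=> // y yS.
pose y' := y - (bil B y f / bil B e f) *: e - (bil B y e / bil B f e) *: f.
have y'S : (y' <= S')%MS.
  rewrite sub_capmx; apply/andP; split.
    by rewrite /y' !addmx_sub // -scaleNr scalemx_sub.
  by apply/in_ker2; rewrite /y' -!scaleNr !bilDl !bilZl !alt !mulr0 !addr0 !mulNr !divfK // !subrr.
have := hv y' y'S; rewrite /y' -!scaleNr !bilDr !bilZr ve vf !mulr0 !addr0; exact.
Qed.

(** A radical vector v of b1 on S is orthogonal to all of S for b1; adding v to
    an isotropic subspace of its b2-orthogonal that avoids v gains one dimension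
    at the cost of two. *)
Lemma common_isotropic B1 B2 m S : alternating B1 -> alternating B2 -> ((2 * m).-1 <= \rank S)%N ->
  exists W, [/\ (W <= S)%MS, (m <= \rank W)%N, isotropic B1 W & isotropic B2 W].
Proof.
move=> a1 a2; elim: m S => [|m IH] S leS.
  by exists 0; split; rewrite ?sub0mx // => x y; rewrite submx0 => /eqP -> _; rewrite /bil !mul0mx mxE.
have [S0 [S0S rS0]] : exists T, (T <= S)%MS /\ \rank T = (2 * m).+1.
  by apply: shrink_mx; apply: leq_trans leS; lia.
have [|v [v0 vS hv]] := @odd_radical B1 S0 a1; first by rewrite rS0 /= oddM.
have [j vj] : exists j, v 0 j != 0.
  apply: NNPP => nex; case/negP: v0; apply/eqP/rowP => j; rewrite mxE.
  by apply/eqP; apply: contraT => vj; case: nex; exists j.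
(* The second column removes v itself from the orthogonal of v. *)
pose M : 'M_(N, 1 + 1) := row_mx (B2 *m v^T) (delta_mx j 0).
pose T := (S0 :&: kermx M)%MS.
have [|W [WT rW i1 i2]] := IH T.
  have := mxrank_mul_ker S0 M; rewrite -/T rS0; have := rank_leq_col (S0 *m M); lia.
have WS0 : (W <= S0)%MS by apply: submx_trans WT (capmxSl _ _).
have Tv y : (y <= W)%MS -> bil B2 y v = 0 /\ y 0 j = 0.
  move=> /submx_trans/(_ WT); rewrite sub_capmx => /andP[_ /sub_kermxP].
  rewrite /M mul_mx_row -[0 in RHS](@row_mx0 _ 1 1 1) mulmxA => /eq_row_mx[/matrixP/(_ 0 0) h1 /matrixP/(_ 0 0) h2].
  by move: h1 h2; rewrite -/(bil B2 y v) -colE [col _ _ _ _]mxE ![(0 : 'M_1) _ _]mxE.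
exists (W + v)%MS; split.
- by rewrite addsmx_sub (submx_trans WS0 S0S) (submx_trans vS S0S).
- have := mxrank_sum_cap W v; have -> : \rank (W :&: v)%MS = 0%N.
    apply/eqP; rewrite mxrank_eq0; apply/rowV0P => y; rewrite sub_capmx => /andP[/Tv[_ yj] /sub_rVP[a ya]].
    by move: yj; rewrite ya mxE => /eqP; rewrite mulf_eq0 (negPf vj) orbF => /eqP ->; rewrite scale0r.
  by rewrite addn0 rank_rV v0 => ->; rewrite addn1 ltnS.
- move=> x y /sub_addsmxP[[x1 x2] /= ->] /sub_addsmxP[[y1 y2] /= ->].
  rewrite [x2]mx11_scalar [y2]mx11_scalar !mul_scalar_mx bilDl !bilDr !bilZl !bilZr a1 i1 ?submxMl //.
  have WS z : (z *m W <= S0)%MS by apply: submx_trans (submxMl _ _) WS0.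
  by rewrite [bil B1 (x1 *m W) v]alternatingC // !hv //; ring.
move=> x y /sub_addsmxP[[x1 x2] /= ->] /sub_addsmxP[[y1 y2] /= ->].
rewrite [x2]mx11_scalar [y2]mx11_scalar !mul_scalar_mx bilDl !bilDr !bilZl !bilZr a2 i2 ?submxMl //.
rewrite [bil B2 v (y1 *m W)]alternatingC //.
by have [-> _] := Tv _ (submxMl x1 W); have [-> _] := Tv _ (submxMl y1 W); ring.
Qed.
End Isotropic.

(** If a is not a square, X^2 - a is irreducible, but its derivative is zero. *)
Lemma perfect_sqrt (k : fieldType) : 2%N \in [pchar k] -> perfect_field k ->
  forall a : k, exists r, r ^+ 2 = a.
Proof.
move=> ch perf a; apply: NNPP => nex.
have sp : size ('X^2 - a%:P : {poly k}) = 3 by rewrite size_XnsubC.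
have irr : irreducible_poly ('X^2 - a%:P : {poly k}).
  apply: cubic_irreducible; rewrite ?sp // => x; apply/negP; rewrite rootE !hornerE => /eqP h.
  by apply: nex; exists x; apply/eqP; rewrite -subr_eq0 expr2 h.
have := perf _ irr; rewrite separable_poly.unlock derivB derivXn derivC subr0.
have -> : ('X^1 *+ 2 : {poly k}) = 0.
  by rewrite -scaler_nat (pcharf0 ch) scale0r.
by rewrite coprimep0 -size_poly_eq1 sp.
Qed.

Section CommonZeros.
Variables (k : fieldType) (N : nat) (A1 A2 : 'M[k]_N).
Hypotheses (ch : 2%N \in [pchar k]) (sqrtk : forall a : k, exists r, r ^+ 2 = a).

Lemma alternating_pol A : alternating (A + A^T : 'M[k]_N).
Proof. by move=> x; rewrite -/(pol A x x) polxx mulrn_pchar. Qed.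

Lemma sqrD2 (x y : k) : (x + y) ^+ 2 = x ^+ 2 + y ^+ 2.
Proof. by rewrite sqrrD mulrn_pchar // addr0. Qed.

(** Where the polar form vanishes the quadratic form is additive, and square
    roots of its values on a basis give a linear form of which it is the
    square. *)
Lemma qf_isotropic (A W : 'M[k]_N) : isotropic (A + A^T) W ->
  exists rho : 'cV[k]_N, forall a : 'rV_N, qf A (a *m W) = ((a *m rho) 0 0) ^+ 2.
Proof.
move=> iso.
have [r hr] : exists r : 'I_N -> k, forall j, r j ^+ 2 = qf A (row j W).
  exists (fun j => xchoose (P := fun r => r ^+ 2 == qf A (row j W)) (let: ex_intro r h := sqrtk (qf A (row j W)) in ex_intro _ r (introT eqP h))).
  by move=> j; apply/eqP; apply: (xchooseP (P := fun r => r ^+ 2 == _)).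
exists (\col_j r j) => a.
rewrite mulmx_sum_row mxE.
pose P (x : 'rV[k]_N) (c : k) := (x <= W)%MS /\ qf A x = c ^+ 2.
suff [] : P (\sum_i a 0 i *: row i W) (\sum_j a 0 j * (\col_j0 r j0) j 0) by [].
apply: (big_ind2 P) => [|x c y d [xW ex] [yW ey]|i _].
- by split; rewrite ?sub0mx // qf0 expr0n.
- by split; [rewrite addmx_sub|rewrite qfD [pol _ _ _]iso // addr0 ex ey sqrD2].
by split; [rewrite scalemx_sub ?row_sub|rewrite qfZ mxE exprMn hr].
Qed.

(** The columns of rho are the two linear forms, in coordinates on W, whose
    squares are q1 and q2; Z is the space of their common zeros. *)
Lemma isotropic_zeros m : ((2 * m).-1 <= N)%N ->
  exists (W Z : 'M[k]_N) (rho : 'M[k]_(N, 1 + 1)),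
  [/\ [/\ (m <= \rank W)%N, isotropic (A1 + A1^T) W, isotropic (A2 + A2^T) W & (Z <= W)%MS],
      forall x, (x <= Z)%MS -> in_base A1 A2 x,
      (\rank W <= \rank Z + \rank rho)%N &
      forall a : 'rV_N, qf A1 (a *m W) = ((a *m rho) 0 (lshift 1 (0 : 'I_1))) ^+ 2 /\
             qf A2 (a *m W) = ((a *m rho) 0 (rshift 1 (0 : 'I_1))) ^+ 2].
Proof.
move=> le.
have [|W [_ rW i1 i2]] := @common_isotropic k N _ _ m 1%:M (@alternating_pol A1) (@alternating_pol A2).
  by rewrite mxrank1.
have [r1 h1] := qf_isotropic i1; have [r2 h2] := qf_isotropic i2.
have hr (a : 'rV_N) : qf A1 (a *m W) = ((a *m row_mx r1 r2) 0 (lshift 1 (0 : 'I_1))) ^+ 2 /\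
             qf A2 (a *m W) = ((a *m row_mx r1 r2) 0 (rshift 1 (0 : 'I_1))) ^+ 2.
  by rewrite mul_mx_row row_mxEl row_mxEr h1 h2.
exists W, (kermx (row_mx r1 r2) *m W), (row_mx r1 r2); split=> //.
- by split=> //; exact: submxMl.
- move=> x /submxP[b ->]; rewrite mulmxA; have [e1 e2] := hr (b *m kermx (row_mx r1 r2)).
  by rewrite /in_base e1 e2 -mulmxA mulmx_ker mulmx0 !mxE expr0n.
have := mxrank_mul_ker (kermx (row_mx r1 r2)) W; rewrite mxrank_ker.
have := mxrankS (capmxSr (kermx (row_mx r1 r2)) (kermx W)); rewrite mxrank_ker.
have := rank_leq_row W; have := rank_leq_row (row_mx r1 r2); lia.
Qed.

Lemma two_indep (Z : 'M[k]_N) : (2 <= \rank Z)%N -> exists u1 u2 : 'rV_N,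
  [/\ (u1 <= Z)%MS, (u2 <= Z)%MS & row_free (col_mx u1 u2)].
Proof.
move=> le; have /rowV0Pn[u1 u1Z u10] : Z != 0 by apply: contraTneq le => ->; rewrite mxrank0.
have : ~~ (Z <= u1)%MS by apply: contraL le => /mxrankS; rewrite rank_rV u10 -ltnNge.
case/row_subPn => i ni; exists u1, (row i Z); split; rewrite ?row_sub //.
apply/indep2P => a b e.
have [b0|b0] := eqVneq b 0.
  by move: e; rewrite b0 scale0r addr0 => /eqP; rewrite scaler_eq0 (negPf u10) orbF => /eqP ->.
case/negP: ni; apply/sub_rVP; exists (- (a / b)).
move: e => /eqP; rewrite addrC addr_eq0 => /eqP e.
by apply: (scalerI b0); rewrite e scalerA -scaleNr; congr (_ *: _); field.
Qed.

Lemma exists_line : (7 <= N)%N -> exists u1 u2 : 'rV_N, is_line A1 A2 u1 u2 /\ row_free (col_mx u1 u2).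
Proof.
move=> le; have [|W [Z [rho [[rW i1 i2 ZW] hZ rZ _]]]] := @isotropic_zeros 4; first by [].
have [|u1 [u2 [u1Z u2Z fr]]] := @two_indep Z; first by have := rank_leq_col rho; lia.
exists u1, u2; split=> //; split; [exact: hZ|exact: hZ| |].
  by apply: i1; apply: submx_trans ZW.
by apply: i2; apply: submx_trans ZW.
Qed.
End CommonZeros.

(** For m = 2: p is the point of X in P(W) and W is spanned by p, e1, e2; the
    vectors z1, z2 are dual to the gradients at p. *)
Definition frame (R : comNzRingType) N (A1 A2 : 'M[R]_N) (p e1 e2 z1 z2 : 'rV[R]_N) : Prop :=
  [/\ [/\ qf A1 p = 0, qf A1 e1 = 1, qf A1 e2 = 0, pol A1 p e1 = 0 & pol A1 p e2 = 0 /\ pol A1 e1 e2 = 0],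
      [/\ qf A2 p = 0, qf A2 e1 = 0, qf A2 e2 = 1, pol A2 p e1 = 0 & pol A2 p e2 = 0 /\ pol A2 e1 e2 = 0],
      pol A1 p z1 = 1 /\ pol A1 p z2 = 0 & pol A2 p z1 = 0 /\ pol A2 p z2 = 1].

(** The two linear forms whose squares are q1 and q2 on W are independent:
    otherwise X contains two points of P(W), and the tangent space of X at each
    of them contains W and has the same dimension, against
    [tangent_distinct]. *)
Lemma exists_frame (k : fieldType) (A1 A2 : 'M[k]_5) : 2%N \in [pchar k] ->
  (forall a : k, exists r, r ^+ 2 = a) -> smooth_pencil A1 A2 ->
  exists p e1 e2 z1 z2, p != 0 /\ frame A1 A2 p e1 e2 z1 z2.
Proof.
move=> ch sq sm.
have [|W [Z [rho [[rW i1 i2 ZW] hZ rZ hrho]]]] := @isotropic_zeros k 5 A1 A2 ch sq 3; first by [].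
have free (x : 'rV_5) : x != 0 -> in_base A1 A2 x -> row_free (col_mx (grad A1 x) (grad A2 x)).
  move=> x0 [q1 q2]; apply/indep2P => s t e; apply: (smoothP sm x0 q1 q2) => y.
  by rewrite !gradE -dot_comb e mul0mx mxE.
have rZ1 : (\rank Z <= 1)%N.
  rewrite leqNgt; apply/negP => /two_indep[g1 [g2 [g1Z g2Z fr]]].
  have [[q1 q2] [q1' q2']] := (hZ _ g1Z, hZ _ g2Z).
  have gW (g : 'rV_5) : (g <= Z)%MS -> (g <= W)%MS by move=> gZ; apply: submx_trans gZ ZW.
  have g10 : g1 != 0.
    apply/eqP => u0; have [|/eqP] := indep2P _ _ fr 1 0; last by rewrite oner_eq0.
    by rewrite u0 scaler0 scale0r addr0.
  have [y [y1 y2]] := tangent_distinct sm q1 q2 q1' q2' (i1 _ _ (gW _ g1Z) (gW _ g2Z)) (i2 _ _ (gW _ g1Z) (gW _ g2Z)) fr.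
  suff yW : (y <= W)%MS by rewrite (i1 _ _ (gW _ g2Z) yW : pol A1 g2 y = 0) (i2 _ _ (gW _ g2Z) yW : pol A2 g2 y = 0) eqxx.
  pose T := kermx (col_mx (grad A1 g1) (grad A2 g1))^T.
  have inT z : pol A1 g1 z = 0 -> pol A2 g1 z = 0 -> (z <= T)%MS.
    move=> z1 z2; apply/sub_kermxP; apply: trmx_inj; rewrite trmx_mul trmxK trmx0 mul_col_mx.
    by rewrite [grad A1 g1 *m _]mx11_scalar [grad A2 g1 *m _]mx11_scalar -!gradE z1 z2 !raddf0 col_mx0.
  have WT : (W <= T)%MS.
    by apply/row_subP => i; apply: inT; [exact: i1 (gW _ g1Z) (row_sub i W)|exact: i2 (gW _ g1Z) (row_sub i W)].
  have := mxrank_leqif_sup WT; rewrite mxrank_ker mxrank_tr (eqP (free _ g10 (conj q1 q2))) => -[rle].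
  have -> : (\rank W == 5 - (1 + 1))%N by rewrite eqn_leq rle.
  move=> /esym TW; apply: submx_trans TW; exact: inT.
have /rowV0Pn[p pZ p0] : Z != 0.
  by apply: contraTneq rZ => ->; rewrite mxrank0; have := rank_leq_col rho; lia.
have [q1 q2] := hZ p pZ.
have pW : (p <= W)%MS by apply: submx_trans pZ ZW.
have /row_fullP[D hD] : row_full rho.
  by rewrite /row_full eqn_leq rank_leq_col; lia.
have DW i : (row i D *m W <= W)%MS by exact: submxMl.
pose l : 'I_(1 + 1) := lshift 1 (0 : 'I_1); pose r : 'I_(1 + 1) := rshift 1 (0 : 'I_1).
have De i j : (row i D *m rho) 0 j = (i == j)%:R by rewrite -row_mul hD !mxE.
have /row_freeP[E hE] := free p p0 (conj q1 q2).
have pE i j : (grad (if i then A2 else A1) p *m E) 0 j = ((if i then r else l) == j)%:R.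
  have := congr1 (fun M : 'M_(1 + 1) => M (if i then r else l) j) hE; rewrite mul_col_mx.
  by case: (i); rewrite /r /l ?col_mxEd ?col_mxEu !mxE.
have pz i j : pol (if i then A2 else A1) p (col j E)^T = ((if i then r else l) == j)%:R.
  by rewrite gradE trmxK -pE !mxE; apply: eq_bigr => s _; rewrite !mxE.
exists p, (row l D *m W), (row r D *m W), (col l E)^T, (col r E)^T; split=> //.
have [a1 a2] := hrho (row l D); have [a3 a4] := hrho (row r D).
rewrite !De /= expr0n expr1n in a1 a2 a3 a4.
have pz1 := pz false l; have pz2 := pz false r; have pz3 := pz true l; have pz4 := pz true r.
by split=> //; split=> //; try split; first [exact: i1 | exact: i2].
Qed.

Lemma frame_map (R S : comNzRingType) (f : {rmorphism R -> S}) N (A1 A2 : 'M[R]_N) p e1 e2 z1 z2 :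
  frame A1 A2 p e1 e2 z1 z2 -> frame (map_mx f A1) (map_mx f A2) (map_mx f p) (map_mx f e1) (map_mx f e2)
    (map_mx f z1) (map_mx f z2).
Proof.
rewrite /frame !qf_map !pol_map.
move=> [[-> -> -> -> [-> ->]] [-> -> -> -> [-> ->]] [-> ->] [-> ->]].
by rewrite rmorph0 rmorph1.
Qed.

(** * The conic fibration of the surface *)

Section Conics.
Variables (R : comNzRingType) (N : nat) (A1 A2 : 'M[R]_N) (p e1 e2 z1 z2 : 'rV[R]_N).

(** The member of the pencil that cuts the fibre over (d1^2 : d2^2) in the
    projection from p.  It is indexed by square roots of the coordinates of the
    base, so that the fibre has the rational point [base_pt]. *)
Definition fibre_pol d1 d2 u v := d2 ^+ 2 * pol A1 u v - d1 ^+ 2 * pol A2 u v.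
Definition fibre_qf d1 d2 u := d2 ^+ 2 * qf A1 u - d1 ^+ 2 * qf A2 u.
Definition base_pt d1 d2 : 'rV[R]_N := d1 *: e1 + d2 *: e2.
Definition dir_pt d1 d2 g h : 'rV[R]_N := g *: e1 + h *: e2 + (d1 ^+ 2 *: z1 + d2 ^+ 2 *: z2).
(** The second point of the conic on the line joining [base_pt] to [dir_pt]. *)
Definition conic_pt d1 d2 g h : 'rV[R]_N :=
  fibre_pol d1 d2 (base_pt d1 d2) (dir_pt d1 d2 g h) *: dir_pt d1 d2 g h
  - fibre_qf d1 d2 (dir_pt d1 d2 g h) *: base_pt d1 d2.
(** The projection from p is inverted by solving either equation for the
    coordinate along p; both give the same point, and the weights m1, m2
    combine them, so that no point with (d1, d2) not zero is lost to a
    vanishing denominator. *)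
Definition conic_unproject m1 m2 y : 'rV[R]_N :=
  (m1 * pol A1 p y + m2 * pol A2 p y) *: y - (m1 * qf A1 y + m2 * qf A2 y) *: p.

Lemma conic_unprojectZ m1 m2 c y : conic_unproject m1 m2 (c *: y) = c ^+ 2 *: conic_unproject m1 m2 y.
Proof. rewrite /conic_unproject !polZE !qfE; apply/rowP => j; rewrite !mxE; ring. Qed.

Hypothesis fr : frame A1 A2 p e1 e2 z1 z2.

Lemma pol_p_dir d1 d2 g h : pol A1 p (dir_pt d1 d2 g h) = d1 ^+ 2 /\ pol A2 p (dir_pt d1 d2 g h) = d2 ^+ 2.
Proof.
case: fr => [[a1 a2 a3 a4 [a5 a6]] [b1 b2 b3 b4 [b5 b6]] [c1 c2] [c3 c4]].
by rewrite /dir_pt !polZE a4 a5 b4 b5 c1 c2 c3 c4; split; ring.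
Qed.

Lemma pol_p_base d1 d2 : pol A1 p (base_pt d1 d2) = 0 /\ pol A2 p (base_pt d1 d2) = 0.
Proof.
case: fr => [[a1 a2 a3 a4 [a5 a6]] [b1 b2 b3 b4 [b5 b6]] [c1 c2] [c3 c4]].
by rewrite /base_pt !polZE a4 a5 b4 b5; split; ring.
Qed.

Lemma fibre_qf_base d1 d2 : fibre_qf d1 d2 (base_pt d1 d2) = 0.
Proof.
case: fr => [[a1 a2 a3 a4 [a5 a6]] [b1 b2 b3 b4 [b5 b6]] [c1 c2] [c3 c4]].
by rewrite /fibre_qf /base_pt !(qfE, polZE) a2 a3 a6 b2 b3 b6; ring.
Qed.

Lemma fibre_qf_conic d1 d2 g h : fibre_qf d1 d2 (conic_pt d1 d2 g h) = 0.
Proof.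
have := fibre_qf_base d1 d2; rewrite /conic_pt /fibre_pol /fibre_qf.
move: (base_pt d1 d2) (dir_pt d1 d2 g h) => u v q0.
rewrite !(qfE, polZE) ![pol _ v u]polC.
set l := _ - _ * pol A2 u v; set s := _ - _ * qf A2 v.
transitivity (l ^+ 2 * (d2 ^+ 2 * qf A1 v - d1 ^+ 2 * qf A2 v) + s ^+ 2 * (d2 ^+ 2 * qf A1 u - d1 ^+ 2 * qf A2 u)
  - l * s * (d2 ^+ 2 * pol A1 u v - d1 ^+ 2 * pol A2 u v)); first by ring.
by rewrite q0 -/l -/s; ring.
Qed.

Lemma pol_p_conic d1 d2 g h :
  let l := fibre_pol d1 d2 (base_pt d1 d2) (dir_pt d1 d2 g h) in
  pol A1 p (conic_pt d1 d2 g h) = l * d1 ^+ 2 /\ pol A2 p (conic_pt d1 d2 g h) = l * d2 ^+ 2.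
Proof.
rewrite /conic_pt /=; move: (pol_p_dir d1 d2 g h) (pol_p_base d1 d2).
move: (base_pt d1 d2) (dir_pt d1 d2 g h) => u v [i1 i2] [i3 i4].
by rewrite !polZE i1 i2 i3 i4; split; ring.
Qed.

Lemma in_base_conic_unproject m1 m2 d1 d2 g h : in_base A1 A2 (conic_unproject m1 m2 (conic_pt d1 d2 g h)).
Proof.
have := fibre_qf_conic d1 d2 g h; have [] := pol_p_conic d1 d2 g h; rewrite /fibre_qf.
move: (conic_pt d1 d2 g h) (fibre_pol _ _ _ _) => y l p1 p2 q.
case: fr => [[a1 _ _ _ _] [b1 _ _ _ _] _ _].
rewrite /conic_unproject; split; rewrite !(qfE, polZE) ![pol _ y p]polC p1 p2 ?a1 ?b1.
  transitivity (l ^+ 2 * (m1 * d1 ^+ 2 + m2 * d2 ^+ 2) * m2 * (d2 ^+ 2 * qf A1 y - d1 ^+ 2 * qf A2 y)); first by ring.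
  by rewrite q mulr0.
transitivity (- (l ^+ 2 * (m1 * d1 ^+ 2 + m2 * d2 ^+ 2) * m1 * (d2 ^+ 2 * qf A1 y - d1 ^+ 2 * qf A2 y))); first by ring.
by rewrite q mulr0 oppr0.
Qed.

(** A point of X that projects to [dir_pt] is recovered: [dir_pt] is then already
    on the conic. *)
Lemma conic_unproject_dir m1 m2 a d1 d2 g h : in_base A1 A2 (a *: p + dir_pt d1 d2 g h) ->
  fibre_qf d1 d2 (dir_pt d1 d2 g h) = 0 /\
  conic_unproject m1 m2 (dir_pt d1 d2 g h) = (m1 * d1 ^+ 2 + m2 * d2 ^+ 2) *: (a *: p + dir_pt d1 d2 g h).
Proof.
have [p1 p2] := pol_p_dir d1 d2 g h.
case: fr => [[a1 _ _ _ _] [b1 _ _ _ _] _ _].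
rewrite /conic_unproject /fibre_qf /in_base p1 p2; move: p1 p2; move: (dir_pt d1 d2 g h) => y p1 p2.
rewrite !(qfE, polZE) a1 b1 p1 p2 => -[q1 q2].
have {}q1 : qf A1 y = - a * d1 ^+ 2.
  by apply/eqP; rewrite -subr_eq0 -[X in _ == X]q1; apply/eqP; ring.
have {}q2 : qf A2 y = - a * d2 ^+ 2.
  by apply/eqP; rewrite -subr_eq0 -[X in _ == X]q2; apply/eqP; ring.
rewrite q1 q2; split; first by ring.
by apply/rowP => j; rewrite !mxE; ring.
Qed.
End Conics.

Section ConicsMap.
Variables (R S : comNzRingType) (f : {rmorphism R -> S}) (N : nat) (A1 A2 : 'M[R]_N) (p e1 e2 z1 z2 : 'rV[R]_N).
Lemma dir_pt_map d1 d2 g h : dir_pt (map_mx f e1) (map_mx f e2) (map_mx f z1) (map_mx f z2) (f d1) (f d2) (f g) (f h)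
  = map_mx f (dir_pt e1 e2 z1 z2 d1 d2 g h).
Proof. by rewrite /dir_pt !map_mxD !map_mxZ !rmorphXn. Qed.
Lemma conic_pt_map d1 d2 g h :
  conic_pt (map_mx f A1) (map_mx f A2) (map_mx f e1) (map_mx f e2) (map_mx f z1) (map_mx f z2) (f d1) (f d2) (f g) (f h)
  = map_mx f (conic_pt A1 A2 e1 e2 z1 z2 d1 d2 g h).
Proof.
rewrite /conic_pt dir_pt_map /base_pt /fibre_pol /fibre_qf -!map_mxZ -!map_mxD !pol_map !qf_map.
by rewrite -!rmorphXn -!rmorphM -!rmorphB -!map_mxZ -map_mxB.
Qed.
Lemma conic_unproject_map m1 m2 y :
  conic_unproject (map_mx f A1) (map_mx f A2) (map_mx f p) (f m1) (f m2) (map_mx f y) = map_mx f (conic_unproject A1 A2 p m1 m2 y).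
Proof. by rewrite /conic_unproject !pol_map !qf_map -!rmorphM -!rmorphD -!map_mxZ -map_mxB. Qed.
End ConicsMap.

Section Kernel.
Variables (K : fieldType) (A1 A2 : 'M[K]_5) (p e1 e2 z1 z2 : 'rV[K]_5).
Hypotheses (ch : 2%N \in [pchar K]) (fr : frame A1 A2 p e1 e2 z1 z2) (p0 : p != 0).

Lemma frame_decomp (x : 'rV[K]_5) : exists a g h c1 c2,
  x = a *: p + (g *: e1 + h *: e2 + (c1 *: z1 + c2 *: z2)).
Proof.
case: fr => [[a1 a2 a3 a4 [a5 a6]] [b1 b2 b3 b4 [b5 b6]] [c1 c2] [c3 c4]].
pose E : 'M[K]_(1 + (1 + (1 + (1 + 1))), 5) := col_mx p (col_mx e1 (col_mx e2 (col_mx z1 z2))).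
have split5 (r : 'rV[K]_(1 + (1 + (1 + (1 + 1))))) : exists a g h c1 c2,
    r = row_mx a%:M (row_mx g%:M (row_mx h%:M (row_mx c1%:M c2%:M))) /\
    r *m E = a *: p + (g *: e1 + h *: e2 + (c1 *: z1 + c2 *: z2)).
  rewrite -[r]hsubmxK; move: (lsubmx r) (rsubmx r) => r1 {}r.
  rewrite -[r]hsubmxK; move: (lsubmx r) (rsubmx r) => r2 {}r.
  rewrite -[r]hsubmxK; move: (lsubmx r) (rsubmx r) => r3 {}r.
  rewrite -[r]hsubmxK; move: (lsubmx r) (rsubmx r) => r4 r5.
  exists (r1 0 0), (r2 0 0), (r3 0 0), (r4 0 0), (r5 0 0); rewrite -!mx11_scalar; split=> //.
  by rewrite !mul_row_col -!mul_scalar_mx -!mx11_scalar !addrA.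
have uE : (E : 'M_5) \in unitmx.
  rewrite -row_free_unit -kermx_eq0; apply/rowV0P => r /sub_kermxP.
  have [a [g [h [y1 [y2 [-> ->]]]]]] := split5 r => e.
  have pp A : qf A p = 0 -> pol A p p = 0 by move=> q; rewrite polxx q mul0rn.
  have y10 : y1 = 0.
    by have := congr1 (pol A1 p) e; rewrite !polZE (pp _ a1) a4 a5 c1 c2 !mulr0 !add0r mulr1 addr0.
  have y20 : y2 = 0.
    by have := congr1 (pol A2 p) e; rewrite !polZE (pp _ b1) b4 b5 c3 c4 !mulr0 !add0r mulr1.
  move: e; rewrite y10 y20 !scale0r !addr0 => e.
  have g0 : g = 0.
    have := congr1 (qf A1) e; rewrite !(qfE, polZE) a1 a2 a3 a4 a5 a6 !mulr0 !addr0 add0r mulr1 => /eqP.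
    by rewrite expf_eq0 => /eqP.
  have h0 : h = 0.
    have := congr1 (qf A2) e; rewrite !(qfE, polZE) b1 b2 b3 b4 b5 b6 !mulr0 !addr0 !add0r mulr1 => /eqP.
    by rewrite expf_eq0 => /eqP.
  move: e; rewrite g0 h0 !scale0r !addr0 => /eqP; rewrite scaler_eq0 (negPf p0) orbF => /eqP ->.
  by rewrite !raddf0 !row_mx0.
have [a [g [h [y1 [y2 [_ e]]]]]] := split5 (x *m invmx (E : 'M_5)).
by exists a, g, h, y1, y2; rewrite -e mulmxKV.
Qed.

(** The parametrization of the fibre degenerates when [base_pt] is a singular
    point of the conic.  Since the derivatives of d1^2 and d2^2 vanish, the
    condition fails to first order only if the member of the pencil is
    orthogonal to e1 and e2 on the whole hyperplane; then e1, e2 and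
    d1^2 z1 + d2^2 z2, each corrected by a multiple of p, are three independent
    kernel vectors. *)
Lemma fibre_pol_neq0 (sm : smooth_pencil A1 A2) d1 d2 g h : (d1 != 0) || (d2 != 0) ->
  (fibre_pol A1 A2 d1 d2 e1 (dir_pt e1 e2 z1 z2 d1 d2 g h) != 0) || (fibre_pol A1 A2 d1 d2 e2 (dir_pt e1 e2 z1 z2 d1 d2 g h) != 0).
Proof.
move=> dnz; apply: contraT; rewrite negb_or !negbK => /andP[/eqP k1 /eqP k2]; exfalso.
have [[a1 a2 a3 a4 [a5 a6]] [b1 b2 b3 b4 [b5 b6]] [c1 c2] [c3 c4]] := fr.
have pxx (A : 'M[K]_5) x : pol A x x = 0 by rewrite polxx mulrn_pchar.
pose s := d2 ^+ 2; pose t := - d1 ^+ 2.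
have tE : d1 ^+ 2 = t by apply/eqP; rewrite -addr_eq0 -mulr2n mulrn_pchar.
have st : (s != 0) || (t != 0) by rewrite /s /t oppr_eq0 !expf_eq0 /= orbC.
pose B u v := s * pol A1 u v + t * pol A2 u v.
have BE u v : fibre_pol A1 A2 d1 d2 u v = B u v by rewrite /fibre_pol /B /t mulNr.
pose w := d1 ^+ 2 *: z1 + d2 ^+ 2 *: z2.
have BC u v : B u v = B v u by rewrite /B ![pol _ v u]polC.
have Bp1 : B p z1 = s by rewrite /B c1 c3; ring.
have Bp2 : B p z2 = t by rewrite /B c2 c4; ring.
have BDl u u' v a b : B (a *: u + b *: u') v = a * B u v + b * B u' v by rewrite /B !polZE; ring.
have BDD u u' v : B (u + u') v = B u v + B u' v by rewrite /B !polZE; ring.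
have BZ u v c : B (c *: u) v = c * B u v by rewrite /B !polZE; ring.
have Bxx u : B u u = 0 by rewrite /B !pxx !mulr0 addr0.
have Bpe1 : B p e1 = 0 by rewrite /B a4 b4; ring.
have Bpe2 : B p e2 = 0 by rewrite /B a5 b5; ring.
have Be : B e1 e2 = 0 by rewrite /B a6 b6; ring.
have Bdir e : B e e1 = 0 -> B e e2 = 0 -> fibre_pol A1 A2 d1 d2 e (dir_pt e1 e2 z1 z2 d1 d2 g h) = 0 ->
    exists eta, B e z1 = eta * s /\ B e z2 = eta * t.
  move=> i1 i2; rewrite BE => i3; apply: proportional2 => //.
  move: i3; rewrite BC /dir_pt !BDD !BZ !(BC _ e) i1 i2 !mulr0 !add0r tE => /eqP.
  by rewrite addr_eq0 => /eqP ->; rewrite oppr_pchar2.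
have [eta1 [h11 h12]] := Bdir _ (Bxx e1) Be k1.
have [eta2 [h21 h22]] := Bdir _ (etrans (BC e2 e1) Be) (Bxx e2) k2.
have kerP v : B v p = 0 -> B v e1 = 0 -> B v e2 = 0 -> B v z1 = 0 -> B v z2 = 0 -> pencil_kernel A1 A2 s t v.
  move=> i1 i2 i3 i4 i5; apply: pol_pencil_kernel => y; rewrite -/(B v y) BC.
  have [a [g' [h' [y1 [y2 ->]]]]] := frame_decomp y.
  by rewrite !BDD !BZ ![B _ v]BC i1 i2 i3 i4 i5 !mulr0 !addr0.
pose b := B z1 z2.
have comb u c x : B (u - c *: p) x = B u x - c * B p x by rewrite /B !polZE; ring.
have kv1 : pencil_kernel A1 A2 s t (e1 - eta1 *: p).
  apply: kerP; rewrite comb ?Bxx ?[B e1 p]BC ?[B e2 p]BC ?Bpe1 ?Bpe2 ?Be ?Bp1 ?Bp2 ?h11 ?h12; ring.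
have kv2 : pencil_kernel A1 A2 s t (e2 - eta2 *: p).
  apply: kerP; rewrite comb ?Bxx ?[B e2 p]BC ?[B e2 e1]BC ?Bpe1 ?Bpe2 ?Be ?Bp1 ?Bp2 ?h21 ?h22; ring.
have Bw x : B w x = t * B z1 x + s * B z2 x by rewrite /w BDl tE.
have dbl x : x *+ 2 = 0 :> K by rewrite mulrn_pchar.
have kv3 : pencil_kernel A1 A2 s t (w - b *: p).
  apply: kerP; rewrite comb Bw.
  - rewrite ![B _ p]BC Bp1 Bp2 Bxx -[RHS](dbl (s * t)); ring.
  - rewrite ![B _ e1]BC [B e1 p]BC h11 h12 Bpe1 -[RHS](dbl (s * t * eta1)); ring.
  - rewrite ![B _ e2]BC [B e2 p]BC h21 h22 Bpe2 -[RHS](dbl (s * t * eta2)); ring.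
  - rewrite Bxx [B z2 z1]BC Bp1 -/b; ring.
  rewrite Bxx Bp2 -/b; ring.
apply: (kernel3_false sm st _ kv1 kv2 kv3).
apply/indep3P => a c d e.
have wp : pol A1 p w = d1 ^+ 2 /\ pol A2 p w = d2 ^+ 2.
  by rewrite /w !polZE c1 c2 c3 c4; split; ring.
have d0 : d = 0.
  have f1 := congr1 (pol A1 p) e; have f2 := congr1 (pol A2 p) e.
  have [w1 w2] := wp.
  move: f1 f2; move: (w) w1 w2 => w0 w1 w2; rewrite !polZE !pxx w1 w2 a4 a5 b4 b5 !mulr0 !subr0 !mulr0 !addr0 !add0r.
  move=> f1 f2; apply: contraTeq dnz => dn; rewrite negb_or !negbK -[d1 == 0]/(true && _) -[d2 == 0]/(true && _) -!(expf_eq0 _ 2).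
  by apply/andP; split; apply/eqP; apply: (mulfI dn); rewrite mulr0.
move: e; rewrite d0 scale0r addr0 => e.
have a0 : a = 0.
  have := congr1 (qf A1) e; rewrite !(qfE, polZE) [pol A1 e1 p]polC [pol A1 e2 p]polC !pxx a1 a2 a3 a4 a5 a6.
  move=> f; have /eqP : a ^+ 2 = 0 by rewrite -[RHS]f; ring.
  by rewrite expf_eq0 => /eqP.
have c0 : c = 0.
  have := congr1 (qf A2) e; rewrite !(qfE, polZE) [pol A2 e1 p]polC [pol A2 e2 p]polC !pxx b1 b2 b3 b4 b5 b6.
  move=> f; have /eqP : c ^+ 2 = 0 by rewrite -[RHS]f; ring.
  by rewrite expf_eq0 => /eqP.
by split.
Qed.
End Kernel.

(** * Unirationality of the surface *)

Section Cover.
Variables (R : comNzRingType) (N : nat) (A1 A2 : 'M[R]_N) (p e1 e2 z1 z2 : 'rV[R]_N).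
(** The variable of index 4 homogenizes: with it the components of [dir_pt] are
    all quadratic, and the map is given by forms of degree 15. *)
Definition cover (v : 'I_7 -> R) : 'rV[R]_N :=
  conic_unproject A1 A2 p (v (inord 5)) (v (inord 6))
    (conic_pt A1 A2 e1 e2 z1 z2 (v (inord 0)) (v (inord 1)) (v (inord 4) * v (inord 2)) (v (inord 4) * v (inord 3))).
Definition params (d1 d2 g h m1 m2 : R) : 'I_7 -> R := fun i => nth 0 [:: d1; d2; g; h; 1; m1; m2] i.
Lemma cover_params d1 d2 g h m1 m2 : cover (params d1 d2 g h m1 m2) =
  conic_unproject A1 A2 p m1 m2 (conic_pt A1 A2 e1 e2 z1 z2 d1 d2 g h).
Proof.
have iE j : (j < 7)%N -> params d1 d2 g h m1 m2 (inord j) = nth 0 [:: d1; d2; g; h; 1; m1; m2] j.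
  by move=> lt; rewrite /params inordK.
rewrite /cover (iE 0 isT) (iE 1 isT) (iE 2 isT) (iE 3 isT) (iE 4 isT) (iE 5 isT) (iE 6 isT).
rewrite /=.
rewrite !mul1r.
reflexivity.
Qed.
Lemma cover_eq v v' : v =1 v' -> cover v = cover v'.
Proof. by move=> h; rewrite /cover !h. Qed.
End Cover.

Lemma cover_map (R S : comNzRingType) (f : {rmorphism R -> S}) (N : nat) (A1 A2 : 'M[R]_N) (p e1 e2 z1 z2 : 'rV[R]_N) v :
  cover (map_mx f A1) (map_mx f A2) (map_mx f p) (map_mx f e1) (map_mx f e2) (map_mx f z1) (map_mx f z2) (fun i => f (v i))
  = map_mx f (cover A1 A2 p e1 e2 z1 z2 v).
Proof. by rewrite /cover -!rmorphM conic_pt_map conic_unproject_map. Qed.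

Notation pC A := (map_mx polyC A).
Notation toF := (@FracField.tofrac {poly _}).

Lemma map_tofrac_eq0 (K : fieldType) m s (V : 'M[{poly K}]_(m, s)) : (map_mx toF V == 0) = (V == 0).
Proof.
apply/eqP/eqP => [/matrixP h|->]; last by rewrite map_mx0.
by apply/matrixP => i j; have /eqP := h i j; rewrite !mxE tofrac_eq0 => /eqP.
Qed.

Lemma scalemx_idomain_eq0 (R : idomainType) m s (c : R) (V : 'M[R]_(m, s)) : c != 0 -> c *: V = 0 -> V = 0.
Proof.
move=> c0 /matrixP h; apply/matrixP => i j; have /eqP := h i j.
by rewrite !mxE mulf_eq0 (negPf c0) => /eqP.
Qed.

Section UniDensity.
Variables (k : fieldType) (e : nat) (g : {mpoly k[5]}).
Hypothesis hg : g \is e.-homog.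

(** Points where the cover is not defined are excluded, since a nonzero constant
    form does not vanish at the zero vector. *)
Definition vanishes_on_cover (K : fieldType) (f0 : {rmorphism k -> K}) (A1 A2 : 'M[K]_5) (p e1 e2 z1 z2 : 'rV[K]_5) :=
  forall (L : fieldType) (f : {rmorphism K -> L}) (v : 'I_7 -> L),
    let x := cover (map_mx f A1) (map_mx f A2) (map_mx f p) (map_mx f e1) (map_mx f e2) (map_mx f z1) (map_mx f z2) v in
    x != 0 -> ev (f \o f0) g x = 0.

Section OverK.
Variables (K : fieldType) (f0 : {rmorphism k -> K}) (A1 A2 : 'M[K]_5) (p e1 e2 z1 z2 : 'rV[K]_5).
Hypotheses (ch : 2%N \in [pchar K]) (fr : frame A1 A2 p e1 e2 z1 z2) (p0 : p != 0) (sm : smooth_pencil A1 A2).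
Hypothesis van : vanishes_on_cover f0 A1 A2 p e1 e2 z1 z2.

(** The counterpart of [curve_limit] for the cover. *)
Lemma cover_limit (D1 D2 G H c : {poly K}) r m1 m2 a x :
  conic_pt (pC A1) (pC A2) (pC e1) (pC e2) (pC z1) (pC z2) D1 D2 G H = c *: r -> c != 0 ->
  conic_unproject A1 A2 p m1 m2 (map_mx (horner_eval 0) r) = a *: x -> a != 0 -> x != 0 -> ev f0 g x = 0.
Proof.
move=> hc c0 hx a0 x0.
have mE s q (A : 'M[K]_(s, q)) : map_mx (@polyF K) A = map_mx toF (pC A) by rewrite -map_mx_comp.
pose y := conic_unproject (pC A1) (pC A2) (pC p) m1%:P m2%:P r.
have y0 : map_mx (horner_eval 0) y = a *: x.
  rewrite -hx /y -conic_unproject_map /= !at0_polyC; congr (conic_unproject _ _ _ _ _ _); by rewrite /horner_eval hornerC.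
have hy : cover (pC A1) (pC A2) (pC p) (pC e1) (pC e2) (pC z1) (pC z2) (params D1 D2 G H m1%:P m2%:P) = c ^+ 2 *: y.
  by rewrite cover_params hc conic_unprojectZ.
have h : ev (@polyF K \o f0) g (map_mx toF (c ^+ 2 *: y)) = 0.
  rewrite -hy -cover_map -!mE; apply: van; rewrite !mE cover_map hy.
  rewrite map_tofrac_eq0; apply: contraNneq a0 => yz; move: y0.
  rewrite (scalemx_idomain_eq0 (expf_neq0 2 c0) yz).
  rewrite map_mx0 => /esym/eqP.
  by rewrite scaler_eq0 (negPf x0) orbF.
have := specialize hg (expf_neq0 2 c0) h; rewrite y0 (ev_homog _ _ _ hg) => /eqP.
by rewrite mulf_eq0 expf_eq0 (negPf a0) andbF => /eqP.
Qed.

Lemma pchar2_poly : 2%:R = 0 :> {poly K}.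
Proof. by rewrite -polyC_natr (pcharf0 ch). Qed.

Lemma sqrDX2 (d f : K) : (d%:P + 'X * f%:P) ^+ 2 = (d ^+ 2)%:P + 'X ^+ 2 * (f ^+ 2)%:P :> {poly K}.
Proof. by rewrite sqrrD -mulr_natr pchar2_poly mulr0 addr0 exprMn !rmorphXn. Qed.

(** Along d1 = t, d2 = 0 the point of the conic tends to e1, the direction of a
    tangent of X at p, and [conic_unproject] sends e1 to a multiple of p. *)
Lemma conic_at_p : exists r : 'rV[{poly K}]_5,
  conic_pt (pC A1) (pC A2) (pC e1) (pC e2) (pC z1) (pC z2) 'X 0 0 1 = 'X ^+ 3 *: r /\
  map_mx (horner_eval 0) r = e1.
Proof.
have [[a1 a2 a3 a4 [a5 a6]] [b1 b2 b3 b4 [b5 b6]] [c1 c2] [c3 c4]] := fr.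
pose y' : 'rV[{poly K}]_5 := pC e2 + 'X ^+ 2 *: pC z1.
pose Q : {poly K} := 1 + 'X ^+ 2 * (pol A2 e2 z1)%:P + 'X ^+ 4 * (qf A2 z1)%:P.
pose r : 'rV[{poly K}]_5 := Q *: pC e1 - ('X ^+ 2 * (pol A2 e1 z1)%:P) *: y'.
exists r; split; last first.
  rewrite /r /Q map_mxB !map_mxZ !at0_polyC /= /horner_eval !hornerE !expr0n /= !mul0r.
  by rewrite !addr0 scale1r scale0r subr0.
have dirE : dir_pt (pC e1) (pC e2) (pC z1) (pC z2) 'X 0 0 1 = y'.
  by rewrite /dir_pt /y' scale0r add0r scale1r expr0n scale0r addr0.
rewrite /conic_pt dirE /fibre_pol /fibre_qf /base_pt scale0r addr0.
have -> : qf (pC A2) y' = Q.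
  by rewrite /y' !(qfE, polZE) !qf_map !pol_map b3 rmorph1 /Q; ring.
have -> : pol (pC A2) ('X *: pC e1) y' = 'X ^+ 3 * (pol A2 e1 z1)%:P.
  by rewrite /y' !polZE !pol_map b6 rmorph0 /=; ring.
by rewrite /r; move: (Q) (pol A2 e1 z1)%:P (y') => Q' b y; apply/rowP => j; rewrite !mxE; ring.
Qed.

Lemma conic_unproject_e1 : conic_unproject A1 A2 p 1 0 e1 = (- 1) *: p.
Proof.
have [[a1 a2 a3 a4 [a5 a6]] [b1 b2 b3 b4 [b5 b6]] [c1 c2] [c3 c4]] := fr.
by rewrite /conic_unproject a2 a4 b2; apply/rowP => j; rewrite !mxE; ring.
Qed.

Lemma dense_at_p : ev f0 g p = 0.
Proof.
have [r [hr r0]] := conic_at_p.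
apply: (cover_limit hr (m1 := 1) (m2 := 0) (a := - 1)) => //.
- by rewrite expf_neq0 ?polyX_eq0.
- by rewrite r0 conic_unproject_e1.
by rewrite oppr_eq0 oner_eq0.
Qed.

(** If l0, the value of [fibre_pol] at [base_pt] and [dir_pt], is not zero, then
    x itself is a value of the cover.  Otherwise d1, d2 move to d1 + t f1,
    d2 + t f2.  As the squares change by multiples of t^2, so does the value of
    the conic at the direction, while by
    [fibre_pol_neq0] l0 acquires a term of order one for some f1, f2; the point
    of the conic divided by t tends to a multiple of [dir_pt]. *)
Lemma dense_off_p d1 d2 a g' h' : let x := a *: p + dir_pt e1 e2 z1 z2 d1 d2 g' h' in
  (d1 != 0) || (d2 != 0) -> in_base A1 A2 x -> x != 0 -> ev f0 g x = 0.
Proof.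
move=> x dnz hx x0.
pose y := dir_pt e1 e2 z1 z2 d1 d2 g' h'.
have [m1 [m2 mnz]] : exists m1 m2, m1 * d1 ^+ 2 + m2 * d2 ^+ 2 != 0.
  case/orP: dnz => nz; [exists 1, 0|exists 0, 1]; rewrite mul0r mul1r ?addr0 ?add0r expf_neq0 //.
have [qy uy] := conic_unproject_dir fr m1 m2 hx; rewrite -/y -/x in qy uy.
pose l0 := fibre_pol A1 A2 d1 d2 (base_pt e1 e2 d1 d2) y.
have unproj_y c : conic_unproject A1 A2 p m1 m2 (c *: y) = (c ^+ 2 * (m1 * d1 ^+ 2 + m2 * d2 ^+ 2)) *: x.
  by rewrite conic_unprojectZ uy scalerA.
have [l00|l0nz] := eqVneq l0 0; last first.
  apply: (@cover_limit d1%:P d2%:P g'%:P h'%:P 1 (pC (l0 *: y)) m1 m2 (l0 ^+ 2 * (m1 * d1 ^+ 2 + m2 * d2 ^+ 2)) x) => //.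
  - rewrite scale1r conic_pt_map; congr (map_mx _ _).
    by rewrite /conic_pt -/y qy -/l0 scale0r subr0.
  - by rewrite oner_eq0.
  - by rewrite at0_polyC unproj_y.
  by rewrite mulf_neq0 ?expf_neq0.
have [f1 [f2 l1nz]] : exists f1 f2, fibre_pol A1 A2 d1 d2 (base_pt e1 e2 f1 f2) y != 0.
  have /orP[nz|nz] := fibre_pol_neq0 ch fr p0 sm g' h' dnz; [exists 1, 0|exists 0, 1];
  by rewrite /base_pt scale1r scale0r ?addr0 ?add0r.
pose v0 := base_pt e1 e2 d1 d2; pose vf := base_pt e1 e2 f1 f2; pose zt := f1 ^+ 2 *: z1 + f2 ^+ 2 *: z2.
pose yt : 'rV[{poly K}]_5 := pC y + 'X ^+ 2 *: pC zt.
pose vt : 'rV[{poly K}]_5 := pC v0 + 'X *: pC vf.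
pose D1 : {poly K} := d1%:P + 'X * f1%:P; pose D2 : {poly K} := d2%:P + 'X * f2%:P.
have dirE : dir_pt (pC e1) (pC e2) (pC z1) (pC z2) D1 D2 g'%:P h'%:P = yt.
  rewrite /dir_pt /D1 /D2 !sqrDX2 /yt /y /zt /dir_pt !map_mxD !map_mxZ /=.
  by apply/rowP => j; rewrite !mxE; ring.
have baseE : base_pt (pC e1) (pC e2) D1 D2 = vt.
  rewrite /base_pt /D1 /D2 /vt /v0 /vf /base_pt !map_mxD !map_mxZ /=.
  by apply/rowP => j; rewrite !mxE; ring.
have qE A : qf (pC A) yt = (qf A y)%:P + 'X ^+ 2 * ((pol A y zt)%:P + 'X ^+ 2 * (qf A zt)%:P).
  by rewrite /yt; move: (y) (zt) => i1 i2; rewrite !(qfE, polZE) !qf_map !pol_map; ring.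
have pE A : pol (pC A) vt yt = (pol A v0 y)%:P + 'X * ((pol A vf y)%:P + 'X * ((pol A v0 zt)%:P + 'X * (pol A vf zt)%:P)).
  by rewrite /vt /yt; move: (v0) (vf) (y) (zt) => i1 i2 i3 i4; rewrite !polZE !pol_map; ring.
pose ka : {poly K} := (f2 ^+ 2)%:P * qf (pC A1) yt - (f1 ^+ 2)%:P * qf (pC A2) yt
  + (d2 ^+ 2)%:P * ((pol A1 y zt)%:P + 'X ^+ 2 * (qf A1 zt)%:P) - (d1 ^+ 2)%:P * ((pol A2 y zt)%:P + 'X ^+ 2 * (qf A2 zt)%:P).
have qtE : fibre_qf (pC A1) (pC A2) D1 D2 yt = 'X ^+ 2 * ka.
  rewrite /fibre_qf /D1 /D2 !sqrDX2.
  transitivity ((fibre_qf A1 A2 d1 d2 y)%:P + 'X ^+ 2 * ka); last by rewrite qy raddf0 add0r.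
  by rewrite /ka !qE /fibre_qf rmorphB !rmorphM /=; ring.
pose la : {poly K} := (fibre_pol A1 A2 d1 d2 vf y)%:P + 'X * ((f2 ^+ 2)%:P * pol (pC A1) vt yt - (f1 ^+ 2)%:P * pol (pC A2) vt yt
  + (d2 ^+ 2)%:P * ((pol A1 v0 zt)%:P + 'X * (pol A1 vf zt)%:P) - (d1 ^+ 2)%:P * ((pol A2 v0 zt)%:P + 'X * (pol A2 vf zt)%:P)).
have ltE : fibre_pol (pC A1) (pC A2) D1 D2 vt yt = 'X * la.
  rewrite /fibre_pol /D1 /D2 !sqrDX2.
  transitivity (l0%:P + 'X * la); last by rewrite l00 raddf0 add0r.
  by rewrite /la !pE /l0 /fibre_pol -/v0 !rmorphB !rmorphM /=; ring.
pose r : 'rV[{poly K}]_5 := la *: yt - ('X * ka) *: vt.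
have r0 : map_mx (horner_eval 0) r = fibre_pol A1 A2 d1 d2 vf y *: y.
  rewrite /r map_mxB !map_mxZ /yt map_mxD map_mxZ !at0_polyC /= /horner_eval /la !hornerE /=.
  by rewrite expr0n !scale0r !addr0 subr0.
apply: (@cover_limit D1 D2 g'%:P h'%:P 'X r m1 m2 (fibre_pol A1 A2 d1 d2 vf y ^+ 2 * (m1 * d1 ^+ 2 + m2 * d2 ^+ 2)) x) => //.
- rewrite /conic_pt dirE baseE qtE ltE /r.
  by move: (la) (ka) (yt) (vt) => l q u w; apply/rowP => j; rewrite !mxE; ring.
- by rewrite polyX_eq0.
- by rewrite r0 unproj_y.
by rewrite mulf_neq0 ?expf_neq0.
Qed.

End OverK.

Lemma vanishes_on_cover_ext (K L : fieldType) (f0 : {rmorphism k -> K}) (f : {rmorphism K -> L}) A1 A2 p e1 e2 z1 z2 :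
  vanishes_on_cover f0 A1 A2 p e1 e2 z1 z2 ->
  vanishes_on_cover (f \o f0) (map_mx f A1) (map_mx f A2) (map_mx f p) (map_mx f e1) (map_mx f e2) (map_mx f z1) (map_mx f z2).
Proof. by move=> h M f' v; rewrite -!map_mx_comp; apply: (h M (f' \o f)). Qed.

(** The square roots of the two coordinates on the base of the fibration are
    adjoined to K.  The coordinates both vanish only at p, because q1 and q2 are
    squares of independent linear forms on W. *)
Theorem dense_cover (K : fieldType) (f0 : {rmorphism k -> K}) A1 A2 p e1 e2 z1 z2 : 2%N \in [pchar K] ->
  frame A1 A2 p e1 e2 z1 z2 -> p != 0 -> smooth_pencil A1 A2 -> vanishes_on_cover f0 A1 A2 p e1 e2 z1 z2 ->
  forall x, in_base A1 A2 x -> x != 0 -> ev f0 g x = 0.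
Proof.
move=> ch fr p0 sm van x.
have [a [g' [h' [c1 [c2 ->]]]]] := frame_decomp fr p0 x => hx x0.
have [[a1 a2 a3 a4 [a5 a6]] [b1 b2 b3 b4 [b5 b6]] _ _] := fr.
have [cnz|] := boolP ((c1 != 0) || (c2 != 0)); last first.
  rewrite negb_or !negbK => /andP[/eqP c10 /eqP c20].
  move: hx x0; rewrite c10 c20 !scale0r !addr0 => -[].
  rewrite !(qfE, polZE) a1 a2 a3 a4 a5 a6 b1 b2 b3 b4 b5 b6 !mulr0 !mulr1 !addr0 !add0r.
  move=> /eqP + /eqP; rewrite !expf_eq0 => /eqP -> /eqP ->; rewrite !scale0r !addr0 => _.
  by rewrite (ev_homog _ _ _ hg) (dense_at_p fr p0 van) mulr0.
have [L1 [f1 [d1 hd1]]] := ext_sqrt c1; have [L2 [f2 [d2 hd2]]] := ext_sqrt (f1 c2).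
pose f : {rmorphism K -> L2} := f2 \o f1.
apply: (fmorph_inj f); rewrite rmorph0 ev_morph.
have chL : 2%N \in [pchar L2] by rewrite (fmorph_pchar f).
have mE : map_mx f (a *: p + (g' *: e1 + h' *: e2 + (c1 *: z1 + c2 *: z2))) =
    f a *: map_mx f p + dir_pt (map_mx f e1) (map_mx f e2) (map_mx f z1) (map_mx f z2) (f2 d1) d2 (f g') (f h').
  by rewrite /dir_pt -rmorphXn hd1 hd2 !map_mxD !map_mxZ.
rewrite mE; apply: (dense_off_p chL (frame_map f fr) _ (smooth_pencil_ext sm) (vanishes_on_cover_ext van)).
- by rewrite map_mx_eq0.
- have sq (z : L2) : (z != 0) = (z ^+ 2 != 0) by rewrite expf_eq0.
  by rewrite sq [d2 != 0]sq -rmorphXn hd1 hd2 !fmorph_eq0.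
- by rewrite -mE; apply: in_base_map.
by rewrite -mE map_mx_eq0.
Qed.
End UniDensity.

Section Unirational.
Variables (k : fieldType) (q : 2.-tuple {mpoly k[5]}) (A1 A2 : 'M[k]_5) (p e1 e2 z1 z2 : 'rV[k]_5).
Hypothesis q1 : tnth q 0 = qf (constmx 5 A1) vecX.
Hypothesis q2 : tnth q 1 = qf (constmx 5 A2) vecX.
Hypotheses (ch : 2%N \in [pchar k]) (fr : frame A1 A2 p e1 e2 z1 z2) (p0 : p != 0) (sm : smooth_pencil A1 A2).

Theorem unirational_of_frame : unirational (eqns_of q).
Proof.
pose V : 'rV[{mpoly k[7]}]_5 := cover (constmx 7 A1) (constmx 7 A2) (constmx 7 p) (constmx 7 e1) (constmx 7 e2) (constmx 7 z1) (constmx 7 z2) (fun i => 'X_i).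
have VE (R : comNzRingType) (f : {rmorphism k -> R}) (x : 'rV[R]_7) : map_mx (evx f x) V =
    cover (map_mx f A1) (map_mx f A2) (map_mx f p) (map_mx f e1) (map_mx f e2) (map_mx f z1) (map_mx f z2) (fun i => x 0 i).
  rewrite -cover_map !map_evxC; apply: cover_eq => i /=; exact: evxX.
have onX (K : fieldType) (f : {rmorphism k -> K}) x := in_zerosE f q1 q2 x.
exists 6%N, (fun i => V 0 i); split; first split.
- exists 15%N; rewrite -/(homogv 15 V).
  have hX i : ('X_i : {mpoly k[7]}) \is 1.-homog by rewrite dhomogX; apply/eqP; exact: mdeg1.
  have hX2 i : ('X_i ^+ 2 : {mpoly k[7]}) \is 2.-homog by exact: (dhomogM (hX i) (hX i)).
  have hXX i j : ('X_i * 'X_j : {mpoly k[7]}) \is 2.-homog by exact: (dhomogM (hX i) (hX j)).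
  rewrite /V /cover; set y := conic_pt _ _ _ _ _ _ _ _ _ _.
  have hy : homogv 7 y.
    rewrite /y /conic_pt.
    set u := dir_pt _ _ _ _ _ _ _ _; set v := base_pt _ _ _ _.
    have hu : homogv 2 u.
      by rewrite /u /dir_pt; do ![apply: homogvD]; apply: (homogvZ (m := 2) (p := 0)) => //; exact: homogvC.
    have hv : homogv 1 v.
      by rewrite /v /base_pt; do ![apply: homogvD]; apply: (homogvZ (m := 1) (p := 0)) => //; exact: homogvC.
    apply: homogvB.
      apply: (homogvZ (m := 5) (p := 2)) => //; rewrite /fibre_pol rpredB //.
        exact: (dhomogM (d := 2) (e := 3) (hX2 _) (homogv_pol _ hv hu)).
      exact: (dhomogM (d := 2) (e := 3) (hX2 _) (homogv_pol _ hv hu)).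
    apply: (homogvZ (m := 6) (p := 1)) => //; rewrite /fibre_qf rpredB //.
      exact: (dhomogM (d := 2) (e := 4) (hX2 _) (homogv_qf _ hu)).
    exact: (dhomogM (d := 2) (e := 4) (hX2 _) (homogv_qf _ hu)).
  rewrite /conic_unproject; apply: homogvB.
    apply: (homogvZ (m := 8) (p := 7)) => //; rewrite rpredD //.
      exact: (dhomogM (d := 1) (e := 7) (hX _) (homogv_pol _ (homogvC _ p) hy)).
    exact: (dhomogM (d := 1) (e := 7) (hX _) (homogv_pol _ (homogvC _ p) hy)).
  apply: (homogvZ (m := 15) (p := 0)); last exact: homogvC.
  rewrite rpredD //.
    exact: (dhomogM (d := 1) (e := 14) (hX _) (homogv_qf _ hy)).
  exact: (dhomogM (d := 1) (e := 14) (hX _) (homogv_qf _ hy)).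
- move=> Z hZ h; apply: proj_space_dense h; apply/eqP => V0.
  have [r [hr r0]] := conic_at_p fr.
  pose x : 'rV[{poly k}]_7 := \row_i params 'X 0 0 1 1 0 i.
  have := VE {poly k} polyC x; rewrite V0 map_mx0.
  rewrite (@cover_eq _ _ _ _ _ _ _ _ _ _ (params 'X 0 0 1 1 0)); last by move=> i; rewrite mxE.
  rewrite cover_params hr conic_unprojectZ => /esym/scalemx_idomain_eq0.
  move=> /(_ (expf_neq0 _ (expf_neq0 _ (negbT (polyX_eq0 _))))) /(congr1 (map_mx (horner_eval 0))).
  rewrite map_mx0 -conic_unproject_map /= !at0_polyC r0 /horner_eval !hornerE (conic_unproject_e1 fr) => /eqP.
  by rewrite scaler_eq0 oppr_eq0 oner_eq0 (negPf p0).
- move=> K f x _ /nonzero_vecE nz; apply/onX; split=> //; rewrite eval_mapE VE.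
  apply: in_base_conic_unproject; exact: frame_map.
move=> Z hZ h K f x /onX[x0 hx]; split=> [|g Zg]; first exact/nonzero_vecE.
have [e hg] := hZ g Zg; rewrite eval_atE.
apply: (dense_cover hg _ (frame_map f fr) _ (smooth_pencil_ext sm) _ hx x0).
- by rewrite (fmorph_pchar f).
- by rewrite map_mx_eq0.
move=> L f' v; rewrite -!map_mx_comp => y y0.
have yE : cover (map_mx (f' \o f) A1) (map_mx (f' \o f) A2) (map_mx (f' \o f) p) (map_mx (f' \o f) e1)
    (map_mx (f' \o f) e2) (map_mx (f' \o f) z1) (map_mx (f' \o f) z2) (fun i => rowv v 0 i) = y.
  by apply: cover_eq => i; rewrite mxE.
have [||_ /(_ g Zg)] := h L (f' \o f) v.
- split=> [|? []]; apply/nonzero_vecE; apply: contraNneq y0 => /rowP v0.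
  have v0' i : v i = 0 by have := v0 i; rewrite !mxE.
  by rewrite /y /cover /conic_unproject !v0' !mul0r !addr0 !scale0r subr0.
- by apply/nonzero_vecE; rewrite eval_mapE VE yE.
by rewrite eval_atE eval_mapE VE yE.
Qed.
End Unirational.

(** * The theorem *)

Lemma has_dim_uniq (k : fieldType) n (X : eqns k n) d d' : has_dim X d -> has_dim X d' -> d = d'.
Proof.
move=> [[Z hZ] mZ] [[Z' hZ'] mZ']; apply/eqP; rewrite eqn_leq.
by rewrite (mZ' _ _ hZ) (mZ _ _ hZ').
Qed.

(** For dim X = n - 2 the Jacobian matrix has rank two at each point of X. *)
Lemma smooth_smooth_pencil (k : fieldType) n (q : 2.-tuple {mpoly k[n.+1]}) A1 A2 d :
  tnth q 0 = qf (constmx n.+1 A1) vecX -> tnth q 1 = qf (constmx n.+1 A2) vecX ->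
  (forall j, (tnth q 0)^`M(j) = grad (constmx n.+1 A1) vecX 0 j) ->
  (forall j, (tnth q 1)^`M(j) = grad (constmx n.+1 A2) vecX 0 j) ->
  has_dim (eqns_of q) d -> (d + 2 = n)%N -> smooth q -> smooth_pencil A1 A2.
Proof.
move=> q1 q2 d1 d2 hd dn [d' hd' sm] L f x s t x0 i1 i2 e.
have dd := has_dim_uniq hd' hd; rewrite dd in sm.
have hx : in_zeros f (eqns_of q) (fun i => x 0 i).
  by apply/(in_zerosE f q1 q2); rewrite rowvK.
have rk := sm L f _ hx.
have JE : jacobian f q (fun i => x 0 i) = col_mx (grad (map_mx f A1) x) (grad (map_mx f A2) x) :> 'M_(1 + 1, n.+1).
  apply/matrixP => i j; rewrite mxE eval_atE rowvK.
  have [->|->] : i = 0 \/ i = 1 by case: i => [[|[|]]] //= p; [left|right]; apply: val_inj.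
    rewrite d1 ev_grad; have -> : (0 : 'I_2) = lshift 1 (0 : 'I_1) by apply: val_inj.
    by rewrite col_mxEu.
  rewrite d2 ev_grad; have -> : (1 : 'I_2) = rshift 1 (0 : 'I_1) by apply: val_inj.
  by rewrite col_mxEd.
rewrite JE in rk.
have fr : row_free (col_mx (grad (map_mx f A1) x) (grad (map_mx f A2) x)).
  apply/eqP/(@addIn d); apply: (etrans rk); rewrite -dn addnC //.
exact: (indep2P _ _ fr).
Qed.

Theorem corollary1p2 (k : fieldType) (hchar : 2%N \in [pchar k])
    (hperf : perfect_field k) (m : nat)
    (q : 2.-tuple {mpoly k[(2 * m).+1]})
    (hquad : forall i, tnth q i \is 2.-homog)
    (hci : complete_intersection q) (hsmooth : smooth q) :
  (has_dim (eqns_of q) 2 -> unirational (eqns_of q)) /\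
  (forall d : nat, has_dim (eqns_of q) d -> (2 < d)%N -> rational (eqns_of q)).
Proof.
have sq := perfect_sqrt hchar hperf.
case: hci => d dm hd.
have [A1 [q1 d1]] := quadratic_form_mx (hquad 0).
have [A2 [q2 d2]] := quadratic_form_mx (hquad 1).
have sm := smooth_smooth_pencil q1 q2 d1 d2 hd dm hsmooth.
clear d1 d2 hquad hsmooth.
split=> [hd2|d' hd' lt].
  have dE := has_dim_uniq hd2 hd; rewrite -dE in dm.
  have mE : m = 2 by lia.
  move: q hd A1 A2 q1 q2 sm hd2; rewrite mE => q hd A1 A2 q1 q2 sm _.
  have [p [e1 [e2 [z1 [z2 [p0 fr]]]]]] := exists_frame hchar sq sm.
  exact: (unirational_of_frame q1 q2 hchar fr p0 sm).
have dE := has_dim_uniq hd' hd; rewrite dE in lt.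
move: q hd A1 A2 q1 q2 sm {hd'}; have -> : (2 * m = d.+2)%N by lia.
move=> q hd A1 A2 q1 q2 sm.
have [|u1 [u2 [line indep]]] := exists_line A1 A2 hchar sq; first by lia.
exact: (rational_of_line q1 q2 sm line indep hd).
Qed.
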